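(* Let $S\subseteq\mathbb{R}^k$ be a semialgebraic set which does not contain a line segment. Consider arbitrary nonzero vectors $a_1,\ldots,a_n\in\mathbb{R}^k$, and let $\xi_1,\dots,\xi_n$ be independent Rademacher random variables. Then $$\mathbb{P}[\xi_1a_1+\ldots+\xi_na_n\in S]\le O_S(n^{-1/2}).$$
   Context: A Rademacher random variable takes the values $1$ and $-1$ with probability $1/2$ each. A semialgebraic set in $\mathbb{R}^k$ is one defined by a finite Boolean combination of real polynomial equations and inequalities. A line segment means a nondegenerate one (of positive length). Asymptotic notation: $O_S(\cdot)$ hides a multiplicative constant depending only on the set $S$ (and its ambient dimension $k$). *)

(* Defs.v *)
From HB Require Import structures.
From mathcomp Require Export all_boot all_order all_algebra.
From mathcomp Require Export all_classical all_reals all_analysis.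
(* The notations of mpoly clash with those of MathComp-Analysis; [Require]
   without [Import] keeps the qualified names usable. *)
From mathcomp Require mpoly.
Export Order.TTheory GRing.Theory Num.Theory.
Export numFieldNormedType.Exports.

Set Implicit Arguments.
Unset Strict Implicit.
Unset Printing Implicit Defensive.

Local Open Scope classical_set_scope.
Local Open Scope ring_scope.

Definition peval (R : realType) (k : nat) (p : mpoly.mpoly k R)
    (x : 'rV[R]_k) : R :=
  mpoly.meval (fun i : 'I_k => x ord0 i) p.

(* Non-strict inequalities and inequations are Boolean combinations of the two
   kinds of atoms below. *)
Inductive semialgebraic (R : realType) (k : nat) : set 'rV[R]_k -> Prop :=
| semialgebraic_eq0 (p : mpoly.mpoly k R) :
    semialgebraic [set x | peval p x = 0]
| semialgebraic_gt0 (p : mpoly.mpoly k R) :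
    semialgebraic [set x | 0 < peval p x]
| semialgebraic_setC (A : set 'rV[R]_k) :
    semialgebraic A -> semialgebraic (~` A)
| semialgebraic_setI (A B : set 'rV[R]_k) :
    semialgebraic A -> semialgebraic B -> semialgebraic (A `&` B)
| semialgebraic_setU (A B : set 'rV[R]_k) :
    semialgebraic A -> semialgebraic B -> semialgebraic (A `|` B).

Definition segment (R : realType) (k : nat) (x y : 'rV[R]_k) : set 'rV[R]_k :=
  [set (1 - t) *: x + t *: y | t in [set t : R | 0 <= t <= 1]].

Definition contains_line_segment (R : realType) (k : nat)
    (S : set 'rV[R]_k) : Prop :=
  exists x y : 'rV[R]_k, x != y /\ segment x y `<=` S.

(* The values 1 and -1 are taken almost surely, not necessarily pointwise. *)
Definition rademacher (R : realType) (d : measure_display)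
    (T : measurableType d) (P : probability T R) (X : {RV P >-> R}) : Prop :=
  P (X @^-1` [set 1]) = (2^-1)%:E /\ P (X @^-1` [set -1]) = (2^-1)%:E.

Definition mutually_independent (R : realType) (d : measure_display)
    (T : measurableType d) (P : probability T R) (n : nat)
    (X : 'I_n -> {RV P >-> R}) : Prop :=
  forall (J : {set 'I_n}) (B : 'I_n -> set R),
    (forall i, i \in J -> measurable (B i)) ->
    P (\bigcap_(i in [set` J]) (X i @^-1` B i)) =
    (\prod_(i in J) P (X i @^-1` B i))%E.

(* Main.v *)
Require Import Defs.
From mathcomp Require Import ring lra zify measurable_realfun.

(* Idea. Restricting to a subspace, one may assume that the vectors contain m >= c n
   disjoint spanning families ("spread"). On every translate of that subspace [S] has
   no segment, hence lies in a hypersurface [F = 0] of bounded degree, and it suffices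
   to show Pr[F(X) = 0] = O(m^(-1/2)) for spread vectors, by induction on the ambient
   dimension k.
   Split X = Y + Z into two spread halves. Halasz' bound gives Pr[Y = y] = O(m^(-k/2)).
   Decompose [F = 0] into pieces S irreducible with respect to polynomials of bounded
   degree; a piece has a defining f of minimal degree. If f has a period, it factors
   through R^(k-1). Otherwise S meets its translates in codimension two, so by
   induction Pr[w + Z, w' + Z in S] = O(m^(-1/2)) for w <> w'. Put
   G = {y | Pr(y + Z in S) >= lam} with lam = K m^(-1/2), K large. Averaging over Z,
   an irreducible W inside G of dimension r has Pr[Y in W] at most C/lam times that of
   a section of W of dimension r-1, so Pr[Y in W] = O(lam^(-r) m^(-k/2)). Hence
   Pr[X in S] <= lam + E_Z Pr[Y in G, Y + Z in S] = O(m^(-1/2)). Dimensions are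
   measured by the growth of Hilbert functions, which keeps all constants uniform. *)

Set Implicit Arguments.
Unset Strict Implicit.
Unset Printing Implicit Defensive.

Local Open Scope classical_set_scope.
Local Open Scope ring_scope.

(** * Rademacher sums *)

Section RademacherSum.
Variable R : realType.

(** The expectation of [F] at the signed sum of the entries of [s], computed by averaging over one
    sign at a time, without a probability space. *)
Fixpoint rexp (V : zmodType) (s : seq V) (F : V -> R) : R :=
  if s is a :: s' then
    (rexp s' (fun x => F (a + x)) + rexp s' (fun x => F (- a + x))) / 2
  else F 0.

Definition ind (V : Type) (P : set V) (x : V) : R := (`[< P x >])%:R.

Definition rprob (V : zmodType) (s : seq V) (P : set V) : R := rexp s (ind P).

Lemma ind_ge0 (V : Type) (P : set V) x : 0 <= ind P x.
Proof. by rewrite ler0n. Qed.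

Lemma ind_le1 (V : Type) (P : set V) x : ind P x <= 1.
Proof. by rewrite /ind; case: asbool; rewrite ?ler01. Qed.

Lemma indT (V : Type) (P : set V) x : P x -> ind P x = 1.
Proof. by move=> /asboolT; rewrite /ind => ->. Qed.

Lemma indF (V : Type) (P : set V) x : ~ P x -> ind P x = 0.
Proof. by move=> /asboolF; rewrite /ind => ->. Qed.

Lemma ind_sub (V U : Type) (P : set V) (Q : set U) x y :
  (P x -> Q y) -> ind P x <= ind Q y.
Proof.
move=> PQ; have [/PQ Qy|nP] := pselect (P x); last by rewrite (indF nP) ind_ge0.
by rewrite (indT Qy) ind_le1.
Qed.

Lemma ind_eq (V U : Type) (P : set V) (Q : set U) x y :
  (P x <-> Q y) -> ind P x = ind Q y.
Proof. by move=> [PQ QP]; apply/eqP; rewrite eq_le !ind_sub. Qed.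

Lemma indM (V : Type) (P Q : set V) x : ind P x * ind Q x = ind (P `&` Q) x.
Proof.
have [Px|nP] := pselect (P x); last by rewrite (indF nP) mul0r indF// => -[].
by rewrite (indT Px) mul1r; apply: ind_eq; split=> // -[].
Qed.

Section Zmod.
Variable V : zmodType.
Implicit Types (s t : seq V) (F G : V -> R) (P Q : set V).

Lemma eq_rexp s F G : F =1 G -> rexp s F = rexp s G.
Proof.
elim: s F G => [|a s IH] F G FG //=.
by congr ((_ + _) / 2); apply: IH => x; exact: FG.
Qed.

Lemma rexpD s F G : rexp s (fun x => F x + G x) = rexp s F + rexp s G.
Proof. by elim: s F G => [|a s IH] F G //=; rewrite !IH; ring. Qed.

Lemma rexpZ s c F : rexp s (fun x => c * F x) = c * rexp s F.
Proof. by elim: s F => [|a s IH] F //=; rewrite !IH; ring. Qed.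

Lemma rexp_cst s c : rexp s (fun=> c) = c.
Proof. by elim: s => [|a s IH] //=; rewrite IH; field. Qed.

Lemma ler_rexp s F G : (forall x, F x <= G x) -> rexp s F <= rexp s G.
Proof.
elim: s F G => [|a s IH] F G FG //=.
by rewrite ler_wpM2r// lerD// IH.
Qed.

Lemma rexp_sum s (I : Type) (r : seq I) (F : I -> V -> R) :
  rexp s (fun x => \sum_(i <- r) F i x) = \sum_(i <- r) rexp s (F i).
Proof.
elim: r => [|i r IH].
  by rewrite big_nil (eq_rexp _ (G := fun=> 0)) ?rexp_cst // => x; rewrite big_nil.
rewrite big_cons -IH -rexpD; apply: eq_rexp => x; exact: big_cons.
Qed.

End Zmod.

Section ZmodSwap.
Variable V : zmodType.
Implicit Types (s t : seq V) (F G : V -> R) (P Q : set V).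

Lemma rexp_cat s t F :
  rexp (s ++ t) F = rexp s (fun y => rexp t (fun z => F (y + z))).
Proof.
elim: s F => [|a s IH] F /=; first by apply: eq_rexp => z; rewrite add0r.
by rewrite !IH; congr ((_ + _) / 2); do 2 apply: eq_rexp => ?; rewrite addrA.
Qed.

Lemma rexp_swap (U : zmodType) s (t : seq U) (H : V -> U -> R) :
  rexp s (fun y => rexp t (fun z => H y z)) =
  rexp t (fun z => rexp s (fun y => H y z)).
Proof.
elim: s H => [|a s IH] H //=; rewrite !IH -rexpD.
by rewrite mulrC -rexpZ; apply: eq_rexp => z; rewrite mulrC.
Qed.

Lemma rexp_catC s t F : rexp (s ++ t) F = rexp (t ++ s) F.
Proof. by rewrite !rexp_cat rexp_swap; do 2 apply: eq_rexp => ?; rewrite addrC. Qed.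

Lemma rexp_catCA s t u F : rexp (s ++ t ++ u) F = rexp (t ++ s ++ u) F.
Proof.
rewrite !catA (rexp_cat (s ++ t)) (rexp_cat (t ++ s)) rexp_catC.
by [].
Qed.

Lemma perm_rexp s t F : perm_eq s t -> rexp s F = rexp t F.
Proof.
elim: s t F => [|a s IH] t F; first by move=> /perm_size/esym/size0nil->.
move=> st; have at_ : a \in t by rewrite -(perm_mem st) mem_head.
case/path.splitPr: at_ st => t1 t2 st.
rewrite -(cat1s a t2) rexp_catCA /=.
have st' : perm_eq s (t1 ++ t2).
  by rewrite -(perm_cons a) (permPl st) -(cat1s a t2) perm_catCA.
by rewrite !(IH _ _ st').
Qed.

Lemma rexp_opp s F : rexp s (fun x => F (- x)) = rexp s F.
Proof.
elim: s F => [|a s IH] F /=; first by rewrite oppr0.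
have E b : rexp s (fun x => F (- (b + x))) = rexp s (fun x => F (- b + x)).
  by rewrite -IH; apply: eq_rexp => x; rewrite opprD opprK.
by rewrite !E opprK addrC.
Qed.

Lemma rexp_bound s F c : (forall x, F x <= c) -> rexp s F <= c.
Proof. by move=> Fc; rewrite -(rexp_cst s c) ler_rexp. Qed.

Lemma rexp_ge0 s F : (forall x, 0 <= F x) -> 0 <= rexp s F.
Proof. by move=> F0; rewrite -(rexp_cst s 0) ler_rexp. Qed.

Lemma rprob_ge0 s P : 0 <= rprob s P.
Proof. exact/rexp_ge0/ind_ge0. Qed.

Lemma rprob_le1 s P : rprob s P <= 1.
Proof. exact/rexp_bound/ind_le1. Qed.

Lemma le_rprob s P Q : P `<=` Q -> rprob s P <= rprob s Q.
Proof. by move=> PQ; apply: ler_rexp => x; apply: ind_sub; exact: PQ. Qed.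

Lemma rprob_bigcup s (Ps : seq (set V)) (c : R) P :
  (forall Q, List.In Q Ps -> rprob s Q <= c) ->
  (forall x, P x -> exists2 Q, List.In Q Ps & Q x) ->
  rprob s P <= (size Ps)%:R * c.
Proof.
move=> bnd cov.
have: rprob s P <= \sum_(Q <- Ps) rprob s Q.
  rewrite /rprob -rexp_sum; apply: ler_rexp => x.
  have [/cov[Q]|nP] := pselect (P x); last first.
    by rewrite (indF nP) sumr_ge0 // => Q _; exact: ind_ge0.
  elim: Ps {bnd cov} => // Q' Ps IH /= [<-|QPs] Qx; rewrite big_cons.
    rewrite (indT Qx); apply: (le_trans (ind_le1 _ _)); rewrite lerDl.
    apply: sumr_ge0 => Q2 _; exact: ind_ge0.
  by rewrite (le_trans (IH QPs Qx)) // lerDr ind_ge0.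
move=> /le_trans; apply.
elim: Ps bnd {cov} => [|Q Ps IH] bnd; first by rewrite big_nil mul0r.
rewrite big_cons /= -natr1 mulrDl mul1r addrC lerD //.
  by apply: IH => *; apply: bnd; right.
by apply: bnd; left.
Qed.

End ZmodSwap.

Lemma rexp_map (U V : zmodType) (f : {additive U -> V}) (s : seq U)
    (F : V -> R) : rexp (map f s) F = rexp s (F \o f).
Proof.
elim: s F => [|a s IH] F /=; first by rewrite raddf0.
by rewrite !IH; congr ((_ + _) / 2); apply: eq_rexp => x /=; rewrite raddfD ?raddfN.
Qed.

End RademacherSum.

Arguments indT {R V P x}.
Arguments indF {R V P x}.
Arguments ind_ge0 {R V} P x.
Arguments ind_le1 {R V} P x.

(** * Polynomial functions of bounded degree *)

Section PolyFun.
Variable R : realType.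

(** The index is an upper bound for the degree, not the degree itself. Working with functions
    instead of formal polynomials turns affine substitution into composition. *)
Inductive polyfun (k : nat) : nat -> ('rV[R]_k -> R) -> Prop :=
| polyfun_cst (c : R) : polyfun 0 (fun=> c)
| polyfun_coord (i : 'I_k) : polyfun 1 (fun x => x ord0 i)
| polyfunD d F G : polyfun d F -> polyfun d G -> polyfun d (fun x => F x + G x)
| polyfunM d e F G :
    polyfun d F -> polyfun e G -> polyfun (d + e) (fun x => F x * G x)
| polyfun_le d e F : (d <= e)%N -> polyfun d F -> polyfun e F.

Lemma polyfun_eq k d (F G : 'rV[R]_k -> R) : F =1 G -> polyfun d F -> polyfun d G.
Proof. by move=> /funext ->. Qed.

Lemma polyfun_cst' k d c : polyfun d ((fun=> c) : 'rV[R]_k -> R).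
Proof. by apply: (polyfun_le (leq0n d)); exact: polyfun_cst. Qed.

Lemma polyfunZ k d c (F : 'rV[R]_k -> R) :
  polyfun d F -> polyfun d (fun x => c * F x).
Proof. exact: (polyfunM (polyfun_cst k c)). Qed.

Lemma polyfunB k d (F G : 'rV[R]_k -> R) :
  polyfun d F -> polyfun d G -> polyfun d (fun x => F x - G x).
Proof.
move=> pF pG; apply: (polyfun_eq (F := fun x => F x + (-1) * G x)).
  by move=> x; rewrite mulN1r.
by apply: polyfunD => //; exact: polyfunZ.
Qed.

Lemma polyfun_sum k d (I : Type) (r : seq I) (F : I -> 'rV[R]_k -> R) :
  (forall i, polyfun d (F i)) -> polyfun d (fun x => \sum_(i <- r) F i x).
Proof.
move=> pF; elim: r => [|i r IH].
  by apply: (polyfun_eq _ (polyfun_cst' _ d 0)) => x; rewrite big_nil.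
by apply: (polyfun_eq _ (polyfunD (pF i) IH)) => x; rewrite big_cons.
Qed.

Lemma polyfun_prod k d (I : Type) (r : seq I) (F : I -> 'rV[R]_k -> R) :
  (forall i, polyfun d (F i)) ->
  polyfun (size r * d) (fun x => \prod_(i <- r) F i x).
Proof.
move=> pF; elim: r => [|i r IH].
  by apply: (polyfun_eq _ (polyfun_cst _ 1)) => x; rewrite big_nil.
by apply: (polyfun_eq _ (polyfunM (pF i) IH)) => x; rewrite big_cons.
Qed.

Lemma polyfun_affine k l (A : 'M[R]_(k, l)) (b : 'rV[R]_l) d F :
  polyfun d F -> polyfun d (fun x : 'rV[R]_k => F (x *m A + b)).
Proof.
elim=> {d F} [c|i|d F G _ pF _ pG|d e F G _ pF _ pG|d e F de _ pF].
- exact: polyfun_cst.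
- apply: (polyfun_eq (F := fun x : 'rV_k => \sum_j A j i * x ord0 j + b ord0 i)).
    by move=> x; rewrite !mxE; congr (_ + _); apply: eq_bigr => j _; rewrite mulrC.
  apply: polyfunD; last exact: polyfun_cst'.
  by apply: polyfun_sum => j; apply: polyfunZ; exact: polyfun_coord.
- exact: polyfunD.
- exact: polyfunM.
- exact: polyfun_le pF.
Qed.

Lemma polyfun_shift k d (F : 'rV[R]_k -> R) v :
  polyfun d F -> polyfun d (fun x => F (x + v)).
Proof.
move=> /(polyfun_affine 1%:M v); apply: polyfun_eq => x; by rewrite mulmx1.
Qed.

Lemma polyfun_line k d (F : 'rV[R]_k -> R) (x v : 'rV[R]_k) :
  polyfun d F -> exists q : {poly R}, forall t, q.[t] = F (x + t *: v).
Proof.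
elim=> {d F} [c|i|d F G _ [p pF] _ [q qG]|d e F G _ [p pF] _ [q qG]|//].
- by exists c%:P => t; rewrite hornerC.
- by exists ((x ord0 i)%:P + (v ord0 i)%:P * 'X) => t; rewrite !hornerE !mxE mulrC.
- by exists (p + q) => t; rewrite hornerD pF qG.
- by exists (p * q) => t; rewrite hornerM pF qG.
Qed.

Lemma poly_vanish (q : {poly R}) : (forall n : nat, q.[n%:R] = 0) -> q = 0.
Proof.
move=> q0; apply: contraPeq (ltnn (size q)) => qN0.
have := @max_poly_roots _ q [seq n%:R | n <- iota 0 (size q)] qN0.
rewrite size_map size_iota => -> //.
  by apply/allP => _ /mapP[n _ ->]; exact/rootP/q0.
rewrite map_inj_uniq ?iota_uniq //; exact: mulrIn (oner_neq0 _).
Qed.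

(** Restriction to the line from a point where [F] is nonzero to an arbitrary [y] reduces the claim
    to univariate polynomials, which have no zero divisors. *)
Lemma polyfun_domain k a b (F G : 'rV[R]_k -> R) :
  polyfun a F -> polyfun b G -> (forall x, F x * G x = 0) ->
  (forall x, F x = 0) \/ (forall x, G x = 0).
Proof.
move=> pF pG FG0.
have [//|/existsNP[x Fx]] := pselect (forall x, F x = 0); first by left.
right=> y.
have [p pE] := polyfun_line x (y - x) pF.
have [q qE] := polyfun_line x (y - x) pG.
have /eqP : p * q = 0 by apply: poly_vanish => n; rewrite hornerM pE qE FG0.
rewrite mulf_eq0 => /orP[]/eqP pq0.
  by case: Fx; rewrite -[x in LHS]addr0 -(scale0r (y - x)) -pE pq0 horner0.
by rewrite -[y](subrK x) addrC -[y - x]scale1r -qE pq0 horner0.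
Qed.

(** Along the direction [v], the difference to [F x] is a polynomial in [t] vanishing at every
    natural number. *)
Lemma polyfun_periodic k d (F : 'rV[R]_k -> R) v :
  polyfun d F -> (forall x, F (x + v) = F x) -> forall t x, F (x + t *: v) = F x.
Proof.
move=> pF per t x; have [q qE] := polyfun_line x v pF.
have per' n : F (x + n%:R *: v) = F x.
  elim: n => [|n IH]; first by rewrite scale0r addr0.
  by rewrite -natr1 scalerDl scale1r addrA per.
suff : q - (F x)%:P = 0.
  by move=> /(congr1 (horner^~ t)); rewrite !hornerE qE => /eqP; rewrite subr_eq0 => /eqP.
by apply: poly_vanish => n; rewrite !hornerE qE per' subrr.
Qed.

(** All [n]-fold iterated differences vanish. This order plays the role of the degree and strictly
    drops under differencing, which drives the descent in [minimal_vanishing]. *)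
Fixpoint diff_vanish (k n : nat) (F : 'rV[R]_k -> R) : Prop :=
  if n is n'.+1 then forall v, diff_vanish n' (fun x => F (x + v) - F x)
  else forall x, F x = 0.

Lemma diff_vanish_eq k n (F G : 'rV[R]_k -> R) :
  F =1 G -> diff_vanish n F -> diff_vanish n G.
Proof. by move=> /funext ->. Qed.

Lemma diff_vanish0 k n : diff_vanish n ((fun=> 0) : 'rV[R]_k -> R).
Proof. by elim: n => //= n IH v; apply: diff_vanish_eq IH => x; rewrite subrr. Qed.

Lemma diff_vanishS k n (F : 'rV[R]_k -> R) : diff_vanish n F -> diff_vanish n.+1 F.
Proof.
elim: n F => [F /= F0 v x|n IH F nF v]; first by rewrite !F0 subrr.
exact/IH/nF.
Qed.

Lemma diff_vanish_le k m n (F : 'rV[R]_k -> R) :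
  (m <= n)%N -> diff_vanish m F -> diff_vanish n F.
Proof. by move=> /subnK <-; elim: (n - m)%N => // j IH /IH; exact: diff_vanishS. Qed.

Lemma diff_vanishD k n (F G : 'rV[R]_k -> R) :
  diff_vanish n F -> diff_vanish n G -> diff_vanish n (fun x => F x + G x).
Proof.
elim: n F G => [F G /= F0 G0 x|n IH F G nF nG v]; first by rewrite F0 G0 addr0.
by apply: diff_vanish_eq (IH _ _ (nF v) (nG v)) => x; ring.
Qed.

Lemma diff_vanish_shift k n (F : 'rV[R]_k -> R) w :
  diff_vanish n F -> diff_vanish n (fun x => F (x + w)).
Proof.
elim: n F => [F F0 x|n IH F nF v]; first exact: F0.
by apply: diff_vanish_eq (IH _ (nF v)) => x; rewrite addrAC.
Qed.

(** Discrete Leibniz rule: the difference of [F * G] along [v] is the difference of [F] times the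
    shifted [G], plus [F] times the difference of [G]. The induction is on a bound for [m + n]. *)
Lemma diff_vanishM k m n (F G : 'rV[R]_k -> R) :
  diff_vanish m F -> diff_vanish n G -> diff_vanish (m + n) (fun x => F x * G x).
Proof.
move: {2}(m + n)%N (leqnn (m + n)) => N.
elim: N m n F G => [|N IH] [|m] [|n] F G //= mnN nF nG;
  try by [move=> x; rewrite nF mul0r | move=> x; rewrite nG mulr0];
  try by [apply: (diff_vanish_eq _ (diff_vanish0 _ _)) => x; rewrite nF mul0r
         |apply: (diff_vanish_eq _ (diff_vanish0 _ _)) => x; rewrite nG mulr0].
- by move=> v; apply: (diff_vanish_eq _ (diff_vanish0 _ _)) => x; rewrite !nF !mul0r subrr.
- by move=> v; apply: (diff_vanish_eq _ (diff_vanish0 _ _)) => x; rewrite !nG !mulr0 subrr.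
move=> v; have mN : (m + n.+1 <= N)%N by lia.
have nN : (m.+1 + n <= N)%N by lia.
have H1 := IH _ _ _ _ mN (nF v) (diff_vanish_shift (n := n.+1) v nG).
have H2 := IH _ _ _ _ nN nF (nG v).
rewrite addSnnS in H2.
by apply: diff_vanish_eq (diff_vanishD H1 H2) => x; ring.
Qed.

Lemma polyfun_diff_vanish k d (F : 'rV[R]_k -> R) :
  polyfun d F -> exists n, diff_vanish n F.
Proof.
elim=> {d F} [c|i|d F G _ [m mF] _ [n nG]|d e F G _ [m mF] _ [n nG]|//].
- by exists 1%N => v x /=; rewrite subrr.
- by exists 2%N => v w x /=; rewrite !mxE; ring.
- exists (maxn m n); apply: diff_vanishD.
    exact: diff_vanish_le (leq_maxl _ _) mF.
  exact: diff_vanish_le (leq_maxr _ _) nG.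
- by exists (m + n)%N; exact: diff_vanishM.
Qed.

(** Exponents are bounded coordinate by coordinate, which makes the number of monomials exactly
    [N.+1 ^ k]. *)
Definition monom k (N : nat) (al : {ffun 'I_k -> 'I_N.+1}) (x : 'rV[R]_k) : R :=
  \prod_i x ord0 i ^+ al i.

Definition monspan k (N : nat) (F : 'rV[R]_k -> R) : Prop :=
  exists c : {ffun 'I_k -> 'I_N.+1} -> R, forall x, F x = \sum_al c al * monom al x.

Lemma monspan_eq k N (F G : 'rV[R]_k -> R) : F =1 G -> monspan N F -> monspan N G.
Proof. by move=> /funext ->. Qed.

Lemma monspanD k N (F G : 'rV[R]_k -> R) :
  monspan N F -> monspan N G -> monspan N (fun x => F x + G x).
Proof.
move=> [c cF] [e eG]; exists (fun al => c al + e al) => x.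
by rewrite cF eG -big_split; apply: eq_bigr => al _; rewrite mulrDl.
Qed.

Lemma monspanZ k N a (F : 'rV[R]_k -> R) :
  monspan N F -> monspan N (fun x => a * F x).
Proof.
move=> [c cF]; exists (fun al => a * c al) => x.
by rewrite cF big_distrr /=; apply: eq_bigr => al _; rewrite mulrA.
Qed.

Lemma monspan_sum k N (I : Type) (r : seq I) (F : I -> 'rV[R]_k -> R) :
  (forall i, monspan N (F i)) -> monspan N (fun x => \sum_(i <- r) F i x).
Proof.
move=> pF; elim: r => [|i r IH].
  exists (fun=> 0) => x; rewrite big_nil big1 // => al _; exact: mul0r.
by apply: (monspan_eq _ (monspanD (pF i) IH)) => x; rewrite big_cons.
Qed.

Lemma monspan_exp k N (e : 'I_k -> nat) :
  (forall i, e i <= N)%N -> monspan N (fun x => \prod_i x ord0 i ^+ e i).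
Proof.
move=> eN; exists (fun al => (al == [ffun i => inord (e i)])%:R) => x.
rewrite (bigD1 [ffun i => inord (e i)]) //= eqxx mul1r [X in _ + X]big1 ?addr0.
  by rewrite /monom; apply: eq_bigr => i _; rewrite ffunE inordK // ltnS.
by move=> al /negPf ->; rewrite mul0r.
Qed.

Lemma polyfun_monspan k d (F : 'rV[R]_k -> R) : polyfun d F -> monspan d F.
Proof.
elim=> {d F} [c|i|d F G _ pF _ pG|d e F G _ [c cF] _ [g gG]|d e F de _ [c cF]].
- have := monspanZ c (monspan_exp (k := k) (N := 0) (e := fun=> 0%N) (fun=> leqnn 0)).
  by apply: monspan_eq => x; rewrite big1 ?mulr1 // => i _; rewrite expr0.
- have := @monspan_exp k 1 (fun j => (j == i) : nat) (fun j => leq_b1 _).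
  apply: monspan_eq => x; rewrite (bigD1 i) //= eqxx expr1 big1 ?mulr1 //.
  by move=> j /negPf ->; rewrite expr0.
- exact: monspanD.
- apply: (monspan_eq (F := fun x => \sum_al \sum_be
      (c al * g be) * \prod_i x ord0 i ^+ (al i + be i))).
    move=> x; rewrite cF gG big_distrl /=; apply: eq_bigr => al _.
    rewrite big_distrr /=; apply: eq_bigr => be _.
    rewrite mulrACA -big_split /=; congr (_ * _); apply: eq_bigr => i _.
    by rewrite exprD.
  apply: monspan_sum => al; apply: monspan_sum => be; apply/monspanZ/monspan_exp.
  by move=> i; rewrite leq_add // -ltnS ltn_ord.
- apply: (monspan_eq (F := fun x => \sum_al c al * \prod_i x ord0 i ^+ al i)).
    by move=> x; rewrite cF.
  apply: monspan_sum => al; apply/monspanZ/monspan_exp => i.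
  by rewrite (leq_trans _ de) // -ltnS ltn_ord.
Qed.

End PolyFun.

(** * Hilbert functions of sets *)

Section Hilbert.
Variable R : realType.

Definition indep_on (k : nat) (W : set 'rV[R]_k) (I : finType)
    (p : I -> 'rV[R]_k -> R) : Prop :=
  forall c : I -> R, (forall x, W x -> \sum_i c i * p i x = 0) ->
    forall i, c i = 0.

(** The affine Hilbert function of [W] at [D], that is, the dimension of the space of restrictions
    to [W] of polynomials of degree at most [D], is at least [h]. *)
Definition hilbert_ge (k : nat) (W : set 'rV[R]_k) (D h : nat) : Prop :=
  exists (I : finType) (p : I -> 'rV[R]_k -> R),
    [/\ #|I| = h, forall i, polyfun D (p i) & indep_on W p].

(** [W] has dimension at most [r], as far as degrees up to [L] can tell. *)
Definition dim_le (k : nat) (W : set 'rV[R]_k) (r e L : nat) : Prop :=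
  forall D h, (D <= L)%N -> hilbert_ge W D h -> (h <= e * D.+1 ^ r)%N.

(** Primality of the vanishing ideal, tested only on factors of total degree at most [N]; this
    truncation keeps the number of components bounded uniformly. *)
Definition irred_upto (k : nat) (N : nat) (W : set 'rV[R]_k) : Prop :=
  forall a b F G, (a + b <= N)%N -> polyfun a F -> polyfun b G ->
    (forall x, W x -> F x * G x = 0) ->
    (forall x, W x -> F x = 0) \/ (forall x, W x -> G x = 0).

Definition alg_closed (k : nat) (N : nat) (W : set 'rV[R]_k) : Prop :=
  forall x, (forall g, polyfun N g -> (forall w, W w -> g w = 0) -> g x = 0) -> W x.

Lemma hilbert_ge_sub k (U W : set 'rV[R]_k) D h :
  U `<=` W -> hilbert_ge U D h -> hilbert_ge W D h.
Proof.
move=> UW [I [p [Ih pD pU]]]; exists I, p; split=> // c cW.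
by apply: pU => x /UW; exact: cW.
Qed.

Lemma dim_le_sub k (U W : set 'rV[R]_k) r e L :
  U `<=` W -> dim_le W r e L -> dim_le U r e L.
Proof. by move=> UW dW D h DL /(hilbert_ge_sub UW); exact: dW. Qed.

Lemma nontrivial_kernel (I J : finType) (A : I -> J -> R) :
  (#|J| < #|I|)%N ->
  exists2 c : I -> R, (exists i, c i != 0) & forall j, \sum_i c i * A i j = 0.
Proof.
move=> JI; pose M : 'M[R]_(#|I|, #|J|) := \matrix_(i, j) A (enum_val i) (enum_val j).
have : kermx M != 0.
  by rewrite kermx_eq0 /row_free neq_ltn (leq_ltn_trans (rank_leq_col M) JI).
case/rowV0Pn => v /sub_kermxP vM v0.
exists (fun i => v ord0 (enum_rank i)).
  by case/rV0Pn: v0 => i vi; exists (enum_val i); rewrite enum_valK.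
move=> j; have /matrixP/(_ ord0 (enum_rank j)) := vM; rewrite !mxE => E.
rewrite -[RHS]E (reindex_onto (@enum_val _ I) (@enum_rank _)) /=; last first.
  by move=> i _; rewrite enum_rankK.
apply: eq_big => [i|i _]; first by rewrite enum_valK eqxx.
by rewrite !mxE enum_valK enum_rankK.
Qed.

Lemma hilbert_ge_bound k (W : set 'rV[R]_k) D h :
  hilbert_ge W D h -> (h <= D.+1 ^ k)%N.
Proof.
move=> [I [p [<- pD pW]]]; rewrite leqNgt; apply/negP => lt.
have /choice[a pE] i : monspan D (p i) by exact/polyfun_monspan/pD.
have [|c [i ci] cE] := @nontrivial_kernel I {ffun 'I_k -> 'I_D.+1} a.
  by rewrite card_ffun !card_ord.
case/eqP: ci; apply: pW => x _.
under eq_bigr do rewrite pE big_distrr.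
rewrite exchange_big big1 // => al _ /=.
under eq_bigr do rewrite mulrA.
by rewrite -big_distrl /= cE mul0r.
Qed.

Lemma dim_leT k L : dim_le [set: 'rV[R]_k] k 1 L.
Proof. by move=> D h _ /hilbert_ge_bound; rewrite mul1n. Qed.

Lemma irred_uptoT k N : irred_upto N [set: 'rV[R]_k].
Proof.
move=> a b F G _ pF pG FG0.
have [H|H] := polyfun_domain pF pG (fun x => FG0 x I); by [left|right].
Qed.

(** Join the functions independent on the section with [g] times those independent on [W]. A
    relation restricted to [g = 0] loses the multiples of [g], so the first coefficients vanish;
    what remains is [g] times a combination, and irreducibility cancels [g]. *)
Lemma hilbert_geM k (W : set 'rV[R]_k) N D E d h l g :
  irred_upto N W -> (d + D <= N)%N -> (d + D <= E)%N -> polyfun d g ->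
  ~ (forall x, W x -> g x = 0) ->
  hilbert_ge W D l -> hilbert_ge (W `&` [set x | g x = 0]) E h ->
  hilbert_ge W E (h + l).
Proof.
move=> irrW dDN dDE pg gW [J [q [Jl qD qW]]] [I [p [Ih pE pW]]].
exists (I + J)%type, (fun s => match s with inl i => p i | inr j => fun x => g x * q j x end).
split; first by rewrite card_sum Ih Jl.
  by case=> [i|j]; [exact: pE|exact: polyfun_le dDE (polyfunM pg (qD j))].
move=> c cW0.
have cW x : W x ->
    \sum_i c (inl i) * p i x + \sum_j c (inr j) * (g x * q j x) = 0.
  by move=> /cW0; rewrite big_sumType.
have c0 i : c (inl i) = 0.
  apply: (pW (fun i => c (inl i))) => x [Wx gx]; rewrite -[RHS](cW x Wx) [X in _ + X]big1 ?addr0 //.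
  by move=> j _; rewrite gx mul0r mulr0.
have pq : polyfun D (fun x => \sum_j c (inr j) * q j x).
  by apply: polyfun_sum => j; exact: polyfunZ.
have gq0 x : W x -> g x * (\sum_j c (inr j) * q j x) = 0.
  move=> Wx; rewrite -[RHS](cW x Wx) [X in _ = X + _]big1 ?add0r; last first.
    by move=> i _; rewrite c0 mul0r.
  by rewrite big_distrr; apply: eq_bigr => j _ /=; ring.
have [//|qW0] := irrW _ _ _ _ dDN pg pq gq0.
by case=> [i //|j]; exact: (qW (fun j => c (inr j)) qW0).
Qed.

(** Multiplication by [g] embeds the functions on [W] into those vanishing on the
    section, so [D+1] copies of the functions of degree [D] on the section fit, linearly
    independent, among the functions of degree [D*(d+1)] on [W]. *)
Lemma dim_le_cut k (W : set 'rV[R]_k) r e d g N L L' :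
  irred_upto N W -> polyfun d g -> ~ (forall x, W x -> g x = 0) ->
  dim_le W r.+1 e L -> (L' * d.+1 <= N)%N -> (L' * d.+1 <= L)%N ->
  dim_le (W `&` [set x | g x = 0]) r (e * d.+1 ^ r.+1) L'.
Proof.
move=> irrW pg gW dW LN LL D h DL hh.
have hl E : (D <= E)%N -> hilbert_ge (W `&` [set x | g x = 0]) E h.
  move=> DE; case: hh => I [p [Ih pD pW]]; exists I, p; split=> // i.
  exact: polyfun_le DE (pD i).
have DN : (D * d.+1 <= N)%N by rewrite (leq_trans _ LN) // leq_mul2r DL orbT.
(* Each further multiplication by [g] costs [d] in degree and makes room for another [h]
   functions. *)
have Hj j : (j <= D)%N -> hilbert_ge W (D + j * d) (j.+1 * h).
  elim: j => [|j IH] jD.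
    by rewrite mul0n addn0 mul1n; apply: (hilbert_ge_sub _ (hl D (leqnn _))) => x [].
  rewrite [in (_ * h)%N]mulSn; apply: (hilbert_geM irrW _ _ pg gW (IH (ltnW jD))).
  - by rewrite (leq_trans _ DN) //; nia.
  - by nia.
  - by apply: hl; exact: leq_addr.
have := dW _ _ _ (Hj D (leqnn _)).
have -> : (D + D * d = D * d.+1)%N by rewrite mulnS.
rewrite (leq_trans _ LL) ?leq_mul2r ?DL ?orbT // => /(_ isT) H.
(* Dividing the bound for [W] by the [D.+1] copies lowers the exponent from [r.+1] to [r]. *)
have : (D.+1 * h <= D.+1 * (e * d.+1 ^ r.+1 * D.+1 ^ r))%N.
  apply: (leq_trans H).
  have -> : (D.+1 * (e * d.+1 ^ r.+1 * D.+1 ^ r) = e * (d.+1 * D.+1) ^ r.+1)%N.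
    by rewrite expnMn [(D.+1 ^ r.+1)%N]expnS; ring.
  by rewrite leq_mul2l leq_exp2r //; apply/orP; right; nia.
by rewrite leq_mul2l.
Qed.

(** Induction on the Hilbert function at degree [N]. A failure of irreducibility covers [U] by two
    sections of strictly smaller Hilbert function, so the number of pieces at most doubles at each
    of the [N.+1 ^ k] levels. *)
Lemma irred_decomposition k N (U : set 'rV[R]_k) :
  exists Ws : seq (set 'rV[R]_k),
    [/\ (size Ws <= 2 ^ (N.+1 ^ k))%N,
        forall W, List.In W Ws ->
          [/\ W `<=` U, irred_upto N W & alg_closed N U -> alg_closed N W] &
        forall x, U x -> exists2 W, List.In W Ws & W x].
Proof.
have : ~ hilbert_ge U N (N.+1 ^ k).+1 by move=> /hilbert_ge_bound; rewrite ltnn.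
elim: (N.+1 ^ k)%N U => [|h IH] U hU.
  exists [:: U]; split=> // [_ [<-|//]|x Ux]; last by exists U => //; left.
  split=> // a b F G abN pF pG FG0; left=> x Ux; apply: contrapT => Fx; apply: hU.
  exists 'I_1, (fun=> F); split; first exact: card_ord.
    by move=> _; apply: polyfun_le pF; exact: leq_trans (leq_addr _ _) abN.
  move=> c /(_ x Ux); rewrite big_ord1 => /eqP; rewrite mulf_eq0 => /orP[/eqP c0|/eqP//].
  by move=> i; rewrite ord1.
have [irrU|] := pselect (irred_upto N U).
  exists [:: U]; split=> [|_ [<-|//]|x Ux]; last by exists U => //; left.
    by rewrite expn_gt0.
  by split.
move=> /existsNP[a] /existsNP[b] /existsNP[F] /existsNP[G].
move=> /not_implyP[abN] /not_implyP[pF] /not_implyP[pG] /not_implyP[FG0].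
move=> /not_orP[F0 G0].
(* [H] vanishes on the section but not on [U], so it can be adjoined to any family independent on
   the section. *)
have low d H : (d <= N)%N -> polyfun d H -> ~ (forall x, U x -> H x = 0) ->
    ~ hilbert_ge (U `&` [set x | H x = 0]) N h.+1.
  move=> dN pH H0 [I [p [Ih pN pI]]]; apply: hU.
  exists (I + 'I_1)%type, (fun o => if o is inl i then p i else H).
  split; first by rewrite card_sum Ih card_ord addn1.
    by case=> [i|_]; [exact: pN|exact: polyfun_le pH].
  move=> c cU.
  have cU' x : U x -> \sum_i c (inl i) * p i x + c (inr ord0) * H x = 0.
    by move=> Ux; rewrite -[RHS](cU x Ux) big_sumType /= big_ord1.
  have cS i : c (inl i) = 0.
    apply: (pI (fun i => c (inl i))) => x [Ux /= Hx].
    by rewrite -[RHS](cU' x Ux) Hx mulr0 addr0.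
  case=> [//|i]; rewrite ord1; have /existsNP[x /not_implyP[Ux Hx]] := H0.
  have := cU' x Ux; rewrite big1 ?add0r; last by move=> j _; rewrite cS mul0r.
  by move=> /eqP; rewrite mulf_eq0 => /orP[/eqP|/eqP].
have aN : (a <= N)%N by lia.
have bN : (b <= N)%N by lia.
have clU d H : (d <= N)%N -> polyfun d H -> alg_closed N U ->
    alg_closed N (U `&` [set x | H x = 0]).
  move=> dN pH cU x xz; split; last first.
    by apply: xz => [|w []//]; exact: polyfun_le pH.
  by apply: cU => g pg gU; apply: xz => // w [/gU].
have [Ws1 [s1 W1 c1]] := IH _ (low _ _ aN pF F0).
have [Ws2 [s2 W2 c2]] := IH _ (low _ _ bN pG G0).
exists (Ws1 ++ Ws2); split.
- by rewrite size_cat expnS mul2n -addnn leq_add.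
- move=> W /(@List.in_app_or _ _ _ _)[/W1|/W2] [WU irrW clW]; split=> //.
  + by move=> x /WU[].
  + by move=> cU; exact/clW/(clU _ _ aN pF).
  + by move=> x /WU[].
  + by move=> cU; exact/clW/(clU _ _ bN pG).
- move=> x Ux; have /eqP := FG0 x Ux; rewrite mulf_eq0 => /orP[]/eqP H0.
    have [W WW Wx] := c1 x (conj Ux H0); exists W => //.
    by apply: List.in_or_app; left.
  have [W WW Wx] := c2 x (conj Ux H0); exists W => //.
  by apply: List.in_or_app; right.
Qed.

Lemma separating_functional k (u v : 'rV[R]_k) : u != v ->
  exists2 l : 'rV[R]_k -> R, polyfun 1 l & l u = 0 /\ l v != 0.
Proof.
rewrite eq_sym -subr_eq0 => /rV0Pn[i]; rewrite !mxE => ui.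
exists (fun x => x ord0 i - u ord0 i); last by rewrite subrr.
by apply: polyfunB; [exact: polyfun_coord|exact: polyfun_cst'].
Qed.

(** Lagrange interpolation: for each point, a product of affine functions killing all the other
    points. *)
Lemma hilbert_ge_points k (W : set 'rV[R]_k) (s : seq 'rV[R]_k) :
  uniq s -> (forall x, x \in s -> W x) -> hilbert_ge W (size s) (size s).
Proof.
move=> us sW.
have /choice[p pP] (x : 'rV[R]_k) :
    exists p, [/\ polyfun (size s) p, forall y, y \in s -> y != x -> p y = 0 & p x != 0].
  elim: (s) => [|y t [p [pt p0 px]]].
    by exists (fun=> 1); split; [exact: polyfun_cst'| |exact: oner_neq0].
  have [yx|yx] := eqVneq y x.
    exists p; split=> //; first exact: polyfun_le (leqnSn _) pt.
    by move=> z; rewrite inE => /orP[/eqP->|]; [rewrite yx eqxx|exact: p0].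
  have [l pl [ly lx]] := separating_functional yx.
  exists (fun z => l z * p z); split; last by rewrite mulf_neq0.
    exact: (polyfunM pl pt).
  by move=> z; rewrite inE => /orP[/eqP-> _|/p0 pz /pz ->]; rewrite ?ly ?mul0r ?mulr0.
exists 'I_(size s), (fun i : 'I_(size s) => p (nth 0 s i)); split; first exact: card_ord.
  by move=> i; have [] := pP (nth 0 s i).
move=> c cW i; have := cW _ (sW _ (mem_nth 0 (ltn_ord i))).
rewrite (bigD1 i) //= big1 ?addr0.
  have [_ _ pi /eqP] := pP (nth 0 s i).
  by rewrite mulf_eq0 => /orP[/eqP//|/eqP pi0]; rewrite pi0 eqxx in pi.
move=> j ji; have [_ p0 _] := pP (nth 0 s j).
by rewrite p0 ?mulr0 ?mem_nth // nth_uniq // eq_sym.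
Qed.

(** Degree [e.+1] suffices to separate [e.+1] points, so that many points would already violate the
    dimension bound. *)
Lemma dim_le0_finite k (W : set 'rV[R]_k) e : dim_le W 0 e e.+1 ->
  exists2 s : seq 'rV[R]_k, (size s <= e)%N & forall x, W x -> x \in s.
Proof.
move=> dW.
have bnd s : uniq s -> (forall x, x \in s -> W x) -> (size s <= e)%N.
  move=> us sW; rewrite leqNgt; apply/negP => es.
  have us' := take_uniq e.+1 us.
  have sW' x : x \in take e.+1 s -> W x by move=> /mem_take; exact: sW.
  have := hilbert_ge_points us' sW'; rewrite size_takel // => hW.
  by have := dW _ _ (leqnn _) hW; rewrite expn0 muln1 ltnn.
apply: contrapT => ns.
have ext n : exists s, [/\ size s = n, uniq s & forall x, x \in s -> W x].
  elim: n => [|n [s [sn us sW]]]; first by exists [::].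
  have [x /not_implyP[Wx xs]] : exists x, ~ (W x -> x \in s).
    by apply/existsNP => H; apply: ns; exists s => //; exact: bnd.
  exists (x :: s); split; first by rewrite /= sn.
    by rewrite /= us andbT; apply/negP.
  by move=> y; rewrite inE => /orP[/eqP->//|]; exact: sW.
have [s [sn us sW]] := ext e.+1.
by have := bnd s us sW; rewrite sn ltnn.
Qed.

End Hilbert.

(** * Concentration at a point *)

Section Concentration.
Variable R : realType.

Lemma rexp_support (V : zmodType) (s : seq V) :
  exists2 U : seq V, uniq U &
    forall F : V -> R, rexp s F = \sum_(u <- U) rprob R s [set u] * F u.
Proof.
have [U HU] : exists U : seq V, forall F G : V -> R,
    (forall u, u \in U -> F u = G u) -> rexp s F = rexp s G.
  elim: s => [|a s [U HU]].
    by exists [:: 0] => F G FG /=; apply: FG; rewrite mem_head.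
  exists ([seq a + u | u <- U] ++ [seq - a + u | u <- U]) => F G FG /=.
  congr ((_ + _) / 2); apply: HU => u uU; apply: FG; rewrite mem_cat.
    by rewrite map_f.
  by rewrite (map_f (fun u => - a + u)) ?orbT.
exists (undup U); first exact: undup_uniq.
move=> F; rewrite (HU F (fun x => \sum_(u <- undup U) F u * ind R [set u] x)).
  by rewrite rexp_sum; apply: eq_bigr => u _; rewrite rexpZ mulrC.
move=> u uU; rewrite (bigD1_seq u) ?mem_undup ?undup_uniq //= indT // mulr1.
by rewrite big1 ?addr0 // => v /eqP vu; rewrite indF ?mulr0 // => /esym.
Qed.

(** The collision probability of two independent copies; the law is symmetric, so their difference
    is distributed as their sum. *)
Lemma rexp_rprob_self (V : zmodType) (s : seq V) :
  rexp s (fun u => rprob R s [set u]) = rprob R (s ++ s) [set 0].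
Proof.
rewrite /rprob rexp_cat; apply: eq_rexp => u; rewrite -rexp_opp.
apply: eq_rexp => y; apply: ind_eq; split => /= [yu|/eqP].
  by rewrite -yu addrC subrr.
by rewrite addr_eq0 => /eqP ->.
Qed.

(** Cauchy-Schwarz for the convolution of two laws, in its arithmetic-mean form. *)
Lemma rprob_cat_le (V : zmodType) (s t : seq V) x :
  rprob R (s ++ t) [set x] <=
  (rprob R (s ++ s) [set 0] + rprob R (t ++ t) [set 0]) / 2.
Proof.
have -> : rprob R (s ++ t) [set x] = rexp s (fun y => rprob R t [set x - y]).
  rewrite /rprob rexp_cat; apply: eq_rexp => y; apply: eq_rexp => z.
  apply: ind_eq; split=> /= [<-|->]; first by rewrite addrC addKr.
  by rewrite addrC subrK.
have [U uU UE] := rexp_support s; rewrite UE.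
(* Bound [p * q] by half of [p ^ 2 + q ^ 2] atom by atom; each sum of squares is a collision
   probability. *)
apply: (@le_trans _ _ (\sum_(u <- U)
    (rprob R s [set u] * rprob R s [set u] +
     rprob R t [set x - u] * rprob R t [set x - u]) / 2)).
  apply: ler_sum => u _.
  move: (rprob R s [set u]) (rprob R t [set x - u]) => p q.
  by have := sqr_ge0 (p - q); rewrite sqrrB; lra.
rewrite -mulr_suml ler_wpM2r// big_split /= -UE rexp_rprob_self lerD2l.
rewrite -rexp_rprob_self.
(* The points [x - u] are distinct for distinct [u], so every [w] is counted at most once. *)
apply: (@le_trans _ _ (rexp t (fun w =>
    \sum_(u <- U) rprob R t [set w] * ind R [set x - u] w))).
  rewrite rexp_sum; apply: ler_sum => u _; rewrite -rexpZ; apply: ler_rexp => w.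
  have [->|nw] := pselect (w = x - u); first exact: lexx.
  by rewrite !(indF (P := [set x - u]) nw) !mulr0.
apply: ler_rexp => w; rewrite -mulr_sumr ler_piMr ?rprob_ge0 //.
have [wU|wU] := boolP (x - w \in U); last first.
  rewrite big_seq big1 // => u uU'; rewrite indF //= => wE; move: wU.
  by rewrite wE subKr uU'.
rewrite (bigD1_seq (x - w)) //= big1 ?addr0 ?ind_le1 // => u /eqP uw.
by rewrite indF //= => wE; apply: uw; rewrite wE subKr.
Qed.

(** Iterated Cauchy-Schwarz replaces a sum of [2^a] blocks by [2^a] copies of one of them. *)
Lemma rprob_flatten_le (V : zmodType) (a : nat) (B : seq (seq V)) (c : R) :
  size B = (2 ^ a)%N ->
  (forall b, b \in B -> forall x, rprob R (iter a (fun t => t ++ t) b) [set x] <= c) ->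
  forall x, rprob R (flatten B) [set x] <= c.
Proof.
elim: a B => [|a IH] B sB HB x.
  case: B sB HB => [|b [|? ?]] //= _ HB; rewrite cats0; apply: HB.
  exact: mem_head.
rewrite -(cat_take_drop (2 ^ a) B) flatten_cat.
(* Two copies of half of the blocks are, up to order, half as many doubled blocks, to which the
   induction hypothesis applies. *)
have half B' : size B' = (2 ^ a)%N -> {subset B' <= B} ->
    rprob R (flatten B' ++ flatten B') [set 0] <= c.
  move=> sB' B'B; have := IH [seq b ++ b | b <- B']; rewrite size_map => /(_ sB').
  have E : perm_eq (flatten B' ++ flatten B') (flatten [seq b ++ b | b <- B']).
    elim: (B') => //= b B2 IHB; rewrite -!catA perm_cat2l perm_catCA.
    by rewrite perm_cat2l.
  rewrite /rprob (perm_rexp _ E); apply => _ /mapP[b /B'B bB ->] y.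
  by rewrite -iterSr; exact: HB.
have sB2 : (2 ^ a <= size B)%N by rewrite sB leq_exp2l.
have H1 := half (take (2 ^ a) B) (size_takel sB2) (@mem_take _ _ _).
have H2 : rprob R (flatten (drop (2 ^ a) B) ++ flatten (drop (2 ^ a) B)) [set 0] <= c.
  apply: half; last exact: mem_drop.
  by rewrite size_drop sB expnS mul2n -addnn addnK.
have := rprob_cat_le (flatten (take (2 ^ a) B)) (flatten (drop (2 ^ a) B)) x.
by lra.
Qed.

Lemma rexp_nseq (V : zmodType) N (v : V) (F : V -> R) :
  rexp (nseq N v) F =
  (\sum_(j < N.+1) 'C(N, j)%:R * F (v *+ j - v *+ (N - j))) / 2 ^+ N.
Proof.
elim: N F => [|N IH] F /=; first by rewrite big_ord1 bin0 mul1r subrr expr0 divr1.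
pose G j := F (v *+ j - v *+ (N.+1 - j)).
rewrite !IH exprS invfM -mulrDl [RHS]mulrA mulrAC.
congr (_ / _ / _).
rewrite (eq_bigr (fun j : 'I_N.+1 => 'C(N, j)%:R * G j.+1)); last first.
  by move=> j _; rewrite /G subSS addrA mulrS.
rewrite [X in _ + X](eq_bigr (fun j : 'I_N.+1 => 'C(N, j)%:R * G j)); last first.
  move=> j _; rewrite /G subSn; last by rewrite -ltnS ltn_ord.
  by rewrite mulrS opprD [in RHS]addrCA.
rewrite [X in _ + X = _]big_ord_recl [RHS]big_ord_recl /= !bin0 addrCA; congr (_ + _).
rewrite /bump /= [RHS](eq_bigr (fun j : 'I_N.+1 => 'C(N, j)%:R * G j.+1 + 'C(N, j.+1)%:R * G j.+1)).
  rewrite [RHS]big_split /=; congr (_ + _); rewrite [RHS]big_ord_recr /= bin_small // mul0r addr0.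
  by [].
by move=> j _; rewrite add1n binS natrD mulrDl addrC.
Qed.

(** Squaring gives the order [n ^ (-1/2)] within the naturals. The induction uses the ratio of
    consecutive central binomial coefficients and [(2n+1)(2n+3) <= 4(n+1)^2]. *)
Lemma central_binomial_bound n : ('C(n.*2, n) ^ 2 * n.*2.+1 <= 16 ^ n)%N.
Proof.
elim: n => [//|n IH].
have E : (n.+1 * 'C(n.+1.*2, n.+1) = 2 * (n.*2.+1 * 'C(n.*2, n)))%N.
  have E1 : (n.+1 * 'C(n.*2.+2, n.+1) = n.*2.+2 * 'C(n.*2.+1, n))%N.
    by rewrite -mul_bin_diag.
  have E2 : 'C(n.*2.+1, n) = 'C(n.*2.+1, n.+1).
    rewrite -bin_sub; first by congr 'C(_, _); lia.
    by lia.
  have E3 : (n.+1 * 'C(n.*2.+1, n.+1) = n.*2.+1 * 'C(n.*2, n))%N.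
    by rewrite -mul_bin_diag.
  by rewrite doubleS E1 -E3 E2; nia.
have : (n.+1 ^ 2 * ('C(n.+1.*2, n.+1) ^ 2 * n.+1.*2.+1) <= n.+1 ^ 2 * 16 ^ n.+1)%N.
  rewrite mulnA -expnMn E.
  have -> : ((2 * (n.*2.+1 * 'C(n.*2, n))) ^ 2 * n.+1.*2.+1 =
     ('C(n.*2, n) ^ 2 * n.*2.+1) * (4 * (n.*2.+1 * n.+1.*2.+1)))%N by ring.
  have -> : (n.+1 ^ 2 * 16 ^ n.+1 = 16 ^ n * (4 * (4 * n.+1 ^ 2)))%N.
    by rewrite [(16 ^ n.+1)%N]expnS; ring.
  by apply: leq_mul => //; rewrite leq_mul2l; nia.
by rewrite leq_pmul2l // expn_gt0.
Qed.

End Concentration.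

(** * Halasz' bound for spread vectors *)

Section Halasz.
Variable R : realType.

(** Cauchy-Schwarz moves the target to the origin, where the probability is a normalised central
    binomial coefficient. *)
Lemma rprob_nseq_le (V : lmodType R) a (v x : V) : v != 0 ->
  rprob R (nseq (2 ^ a) v) [set x] <= (Num.sqrt (2 ^+ a))^-1.
Proof.
move=> v0; case: a => [|a]; first by rewrite expr0 sqrtr1 invr1 rprob_le1.
set n := (2 ^ a)%N; set b := rprob R (nseq (2 ^ a.+1) v) [set 0].
have nE : nseq (2 ^ a.+1) v = nseq n v ++ nseq n v by rewrite -nseqD addnn -mul2n -expnS.
have -> : rprob R (nseq (2 ^ a.+1) v) [set x] = rprob R (nseq n v ++ nseq n v) [set x].
  by rewrite nE.
apply: (le_trans (rprob_cat_le _ _ _ _)); rewrite -nE -/b.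
have -> : (b + b) / 2 = b by field.
have n2 : (2 ^ a.+1 = n.*2)%N by rewrite expnS mul2n.
have bE : b = 'C(n.*2, n)%:R / 2 ^+ n.*2.
  rewrite /b /rprob rexp_nseq n2; congr (_ / _).
  have lt : (n < n.*2.+1)%N by rewrite ltnS -addnn leq_addr.
  rewrite (bigD1 (Ordinal lt)) //= -[X in (X - n)%N]addnn addnK subrr indT // mulr1.
  rewrite big1 ?addr0 // => j jn; rewrite indF ?mulr0 //= => /eqP.
  rewrite subr_eq0 -(scaler_nat j v) -(scaler_nat (n.*2 - j) v) -subr_eq0 -scalerBl scaler_eq0 (negPf v0) orbF.
  rewrite subr_eq0 eqr_nat => /eqP E; case/eqP: jn; apply/val_inj => /=.
  by have := ltn_ord j; lia.
have b0 : 0 <= b by exact: rprob_ge0.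
have q0 : 0 < 2 ^+ a.+1 :> R by rewrite exprn_gt0.
rewrite -[X in _ <= X]mul1r ler_pdivlMr ?sqrtr_gt0 //.
rewrite -(@ler_pXn2r _ 2) ?nnegrE ?mulr_ge0 ?sqrtr_ge0 // expr1n exprMn (sqr_sqrtr (ltW q0)).
rewrite bE expr_div_n mulrAC ler_pdivrMr ?exprn_gt0 // mul1r.
rewrite -!natrX -natrM ler_nat n2 -!expnM.
have -> : (2 ^ (n.*2 * 2) = 16 ^ n)%N by rewrite -(expnM 2 4); congr expn; lia.
by apply: leq_trans (central_binomial_bound n); rewrite leq_mul2l leqnSn orbT.
Qed.

Lemma ler_rexp_in (V : vectType R) (U : {vspace V}) (s : seq V) (F G : V -> R) :
  {subset s <= U} -> (forall x, x \in U -> F x <= G x) -> rexp s F <= rexp s G.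
Proof.
elim: s F G => [|a s IH] F G sU FG /=; first by apply: FG; exact: mem0v.
have aU : a \in U by apply: sU; exact: mem_head.
have sU' : {subset s <= U} by move=> x xs; apply: sU; rewrite inE xs orbT.
rewrite ler_wpM2r ?invr_ge0 // lerD // IH // => x xU; apply: FG.
  by rewrite memvD.
by rewrite memvD // memvN.
Qed.

Lemma iter_dbl_cat (T : eqType) a (s t : seq T) :
  perm_eq (iter a (fun u => u ++ u) (s ++ t))
          (iter a (fun u => u ++ u) s ++ iter a (fun u => u ++ u) t).
Proof.
elim: a => //= a IH; apply: (@perm_trans _ ((iter a (fun u => u ++ u) s ++ iter a (fun u => u ++ u) t)
  ++ (iter a (fun u => u ++ u) s ++ iter a (fun u => u ++ u) t))).
  exact: perm_cat.
by rewrite -!catA perm_cat2l perm_catCA.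
Qed.

Lemma mem_iter_dbl (T : eqType) a (s : seq T) :
  {subset iter a (fun u => u ++ u) s <= s}.
Proof. by elim: a => //= a IH x; rewrite mem_cat => /orP[]; exact: IH. Qed.

Lemma iter_dbl1 (T : Type) a (x : T) : iter a (fun u => u ++ u) [:: x] = nseq (2 ^ a) x.
Proof. by elim: a => //= a ->; rewrite -nseqD addnn -mul2n -expnS. Qed.

(** By freeness [x] splits in at most one way into a multiple of [v] and an element of the span of
    the rest, so the point probability factors over the basis vectors. *)
Lemma rprob_free_le (V : vectType R) a (b : seq V) x : free b ->
  rprob R (iter a (fun u => u ++ u) b) [set x] <= (Num.sqrt (2 ^+ a))^-1 ^+ size b.
Proof.
elim: b x => [|v b IH] x fb; first by rewrite expr0 rprob_le1.
move: fb; rewrite free_cons => /andP[vb fb].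
have v0 : v != 0 by apply: contraNneq vb => ->; rewrite mem0v.
have E := iter_dbl_cat a [:: v] b.
rewrite /rprob (perm_rexp _ E) iter_dbl1 /= rexp_cat.
set t := iter a _ b.
have tb : {subset t <= <<b>>%VS}.
  by move=> y /mem_iter_dbl yb; exact: memv_span.
have sv : {subset nseq (2 ^ a) v <= <[v]>%VS}.
  by move=> y /nseqP[-> _]; exact: memv_line.
have [[y0 [z0 [y0v z0b xE]]]|nx] := pselect (exists y0 z0,
    [/\ y0 \in <[v]>%VS, z0 \in <<b>>%VS & x = y0 + z0]); last first.
  rewrite (le_trans (y := 0)) ?exprn_ge0 ?invr_ge0 ?sqrtr_ge0 //.
  rewrite -(rexp_cst (nseq (2 ^ a) v) 0); apply: (ler_rexp_in sv) => y yv.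
  rewrite -(rexp_cst t 0); apply: (ler_rexp_in tb) => z zb.
  by rewrite indF //= => xE; apply: nx; exists y, z.
apply: (@le_trans _ _ (rprob R (nseq (2 ^ a) v) [set y0] * rprob R t [set z0])).
  rewrite /rprob mulrC -rexpZ; apply: (ler_rexp_in sv) => y yv.
  rewrite mulrC -rexpZ; apply: (ler_rexp_in tb) => z zb.
  rewrite -[X in _ <= X]mulrC.
  have [yz|nyz] := pselect (y + z = x); last by rewrite indF // mulr_ge0 ?ind_ge0.
  have : y - y0 = z0 - z.
    by apply/eqP; rewrite subr_eq addrAC eq_sym subr_eq addrC -xE -yz addrC.
  move=> E1; have : y - y0 \in (<[v]> :&: <<b>>)%VS.
    by rewrite memv_cap memvB //= E1 memvB.
  have -> : (<[v]> :&: <<b>> = 0)%VS.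
    apply/eqP; rewrite -subv0; apply/subvP => u; rewrite memv_cap => /andP[].
    case/vlineP => c ->; have [->|c0] := eqVneq c 0; first by move=> _; rewrite scale0r mem0v.
    by rewrite rpredZeq (negPf c0) /= (negPf vb).
  rewrite memv0 subr_eq0 => /eqP yE.
  have zE : z = z0 by apply/esym/eqP; rewrite -subr_eq0 -E1 yE subrr.
  by rewrite yE zE (indT (P := [set y0])) // (indT (P := [set z0])) // mulr1 ind_le1.
rewrite exprS ler_pM ?rprob_ge0 //; first exact: rprob_nseq_le.
exact: IH.
Qed.

Definition spread (V : vectType R) (m : nat) (s : seq V) : Prop :=
  exists (B : seq (seq V)) (r : seq V),
    [/\ size B = m, forall b, b \in B -> <<b>>%VS = fullv &
        perm_eq s (flatten B ++ r)].

Lemma free_sub_span (V : vectType R) (X : seq V) :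
  exists Y Z : seq V, [/\ perm_eq X (Y ++ Z), free Y & <<Y>>%VS = <<X>>%VS].
Proof.
elim: X => [|x X [Y [Z [XYZ fY YX]]]].
  by exists [::], [::]; split=> //; exact: nil_free.
have [xX|xX] := boolP (x \in <<X>>%VS).
  exists Y, (x :: Z); split=> //.
    by rewrite -cat1s perm_sym -[x :: Z]cat1s perm_catCA perm_cat2l perm_sym.
  by rewrite span_cons YX; apply/esym/addv_idPr; rewrite -memvE.
exists (x :: Y), Z; split=> //=; first by rewrite perm_cons.
  by rewrite free_cons YX xX.
by rewrite !span_cons YX.
Qed.

Definition rsqrt (m : nat) : R := (Num.sqrt m%:R)^-1.

Lemma rsqrt_ge0 m : 0 <= rsqrt m.
Proof. by rewrite invr_ge0 sqrtr_ge0. Qed.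

Lemma rsqrt_gt0 m : (0 < m)%N -> 0 < rsqrt m.
Proof. by move=> m0; rewrite invr_gt0 sqrtr_gt0 ltr0n. Qed.

Lemma rsqrt_le (m n c : nat) : (0 < n)%N -> (n <= c ^ 2 * m)%N -> rsqrt m <= c%:R * rsqrt n.
Proof.
move=> n0 ncm; have m0 : (0 < m)%N by case: m ncm => //; rewrite muln0 leqNgt n0.
rewrite /rsqrt ler_pdivlMr ?sqrtr_gt0 ?ltr0n // mulrC ler_pdivrMr ?sqrtr_gt0 ?ltr0n //.
have -> : c%:R = Num.sqrt (c%:R ^+ 2) :> R by rewrite sqrtr_sqr ger0_norm.
rewrite -sqrtrM ?sqr_ge0 // ler_sqrt ?mulr_ge0 ?sqr_ge0 //.
by rewrite -natrX -natrM ler_nat.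
Qed.

(** Each block is thinned to a basis, and a power of two of these bases is compared with copies of a
    single one. Rounding [m] down to that power costs the factor 2. *)
Lemma spread_point k m (s : seq 'rV[R]_k) x : (0 < m)%N -> spread m s ->
  rprob R s [set x] <= (2 * rsqrt m) ^+ k.
Proof.
move=> m0 [B [r [sB spB /perm_rexp E]]]; rewrite /rprob E.
have /choice[f fP] (b : seq 'rV[R]_k) : exists Y, b \in B ->
    exists Z, [/\ perm_eq b (Y ++ Z), free Y & size Y = k].
  have [bB|] := boolP (b \in B); last by exists [::].
  have [Y [Z [bYZ fY Yb]]] := free_sub_span b; exists Y => _; exists Z; split=> //.
  by move: fY; rewrite /free Yb (spB _ bB) dimvf /dim /= mul1n => /eqP.
have [r' Er'] : exists r', perm_eq (flatten B ++ r) (flatten (map f B) ++ r').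
  elim: (B) fP => [|b B' IH] fP; first by exists r.
  have [|r' Er'] := IH; first by move=> c cB; apply: fP; rewrite inE cB orbT.
  have [Z [bYZ _ _]] := fP b (mem_head _ _).
  exists (Z ++ r'); rewrite /= -!catA.
  apply: (@perm_trans _ ((f b ++ Z) ++ (flatten [seq f i | i <- B'] ++ r'))).
    exact: perm_cat.
  by rewrite -catA perm_cat2l perm_catCA.
rewrite (perm_rexp _ Er').
pose a := trunc_log 2 m.
have am : (2 ^ a <= m)%N by rewrite trunc_logP.
have ma : (m < 2 ^ a.+1)%N by rewrite trunc_log_ltn.
(* Condition on all vectors outside the chosen bases; they only shift the target point. *)
rewrite -(cat_take_drop (2 ^ a) (map f B)) flatten_cat -catA rexp_catC rexp_cat.
apply: rexp_bound => z.
have -> : rexp (flatten (take (2 ^ a) [seq f i | i <- B])) (fun z0 => ind R [set x] (z + z0)) =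
    rprob R (flatten (take (2 ^ a) [seq f i | i <- B])) [set x - z].
  apply: eq_rexp => y; apply: ind_eq; split=> /= [<-|->]; first by rewrite addrC addKr.
  by rewrite addrC subrK.
apply: (@le_trans _ _ ((Num.sqrt (2 ^+ a))^-1 ^+ k)); last first.
  rewrite lerXn2r ?nnegrE ?invr_ge0 ?sqrtr_ge0 ?mulr_ge0 ?rsqrt_ge0 //.
  rewrite -natrX; apply: (@rsqrt_le _ _ 2) => //.
  by move: ma; rewrite expnS; lia.
apply: (@rprob_flatten_le _ _ a); first by rewrite size_takel // size_map sB.
move=> b /mem_take/mapP[b0 b0B ->] y.
have [Z [_ fY sY]] := fP _ b0B.
by rewrite -[k in _ ^+ k]sY; exact: rprob_free_le.
Qed.

End Halasz.

(** * Spread vectors and a hypersurface *)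

Section Hypersurface.
Variable R : realType.

Lemma rprob_cat (V : zmodType) (s t : seq V) (S : set V) :
  rprob R (s ++ t) S = rexp s (fun y => rprob R t [set z | S (y + z)]).
Proof. by rewrite /rprob rexp_cat. Qed.

Lemma rprobI_ind (V : zmodType) (s : seq V) (W S : set V) :
  rexp s (fun y => ind R W y * ind R S y) = rprob R s (W `&` S).
Proof. by apply: eq_rexp => y; exact: indM. Qed.

(** Points [y] with [Pr(y + Z \in S) >= lam] are rare: average over [Z] the
    measure of [W] cut by [S - Z]. Either both [w] and [w'] survive the cut, which is
    unlikely, or the dimension of [W] drops. *)
Lemma level_set_bound k N r e : exists C L : nat,
  forall (sY sZ : seq 'rV[R]_k) (S W : set 'rV[R]_k) (lam M : R),
    alg_closed N S -> 0 < lam <= 1 ->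
    (forall y, rprob R sY [set y] <= M) ->
    ((0 < r)%N -> forall w w', w <> w' ->
       rprob R sZ [set z | S (w + z) /\ S (w' + z)] <= lam / 2) ->
    (forall y, W y -> lam <= rprob R sZ [set z | S (y + z)]) ->
    irred_upto L W -> dim_le W r e L ->
    rprob R sY W <= C%:R * M / lam ^+ r.
Proof.
elim: r e => [|r IH] e.
  exists e, e.+1 => sY sZ S W lam M _ _ hM _ _ _ /dim_le0_finite[s se Ws].
  have M0 : 0 <= M := le_trans (rprob_ge0 _ _ _) (hM 0).
  rewrite expr0 divr1; apply: (@le_trans _ _ ((size s)%:R * M)); last first.
    by rewrite ler_wpM2r // ler_nat.
  rewrite -(size_map (fun x => [set x]) s); apply: rprob_bigcup.
    by move=> Q; elim: (s) => //= x t IHt [<-|//]; exact: hM.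
  move=> x /Ws xs; exists [set x] => //.
  elim: (s) xs => //= y t IHt; rewrite inE => /orP[/eqP->|/IHt]; by [left|right].
have [C' [L' H]] := IH (e * N.+1 ^ r.+1)%N.
(* The 2 comes from absorbing half of [lam], the power of 2 counts components, and the successor
   covers a [W] with at most one point. The degree [L' * N.+1] is what a cut by a polynomial of
   degree [N] requires. *)
exists (2 * (2 ^ (L'.+1 ^ k) * C')).+1, (L' * N.+1)%N.
move=> sY sZ S W lam M clS /andP[lam0 lam1] hM stay hW irrW dW.
have M0 : 0 <= M := le_trans (rprob_ge0 _ _ _) (hM 0).
have lamr n : 0 < lam ^+ n by rewrite exprn_gt0.
have [[w [w' [Ww Ww' ww']]]|single] :=
    pselect (exists w w', [/\ W w, W w' & w <> w']); last first.
  apply: (@le_trans _ _ M).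
    have [[w Ww]|nW] := pselect (exists w, W w).
      apply: le_trans (hM w); apply: le_rprob => x Wx.
      by apply: contrapT => xw; apply: single; exists x, w.
    apply: le_trans (hM 0); apply: le_rprob => x Wx.
    by case: nW; exists x.
  rewrite ler_pdivlMr // mulrC ler_wpM2r //; apply: (@le_trans _ _ 1).
    by rewrite exprn_ile1 // ltW.
  by rewrite ler1n.
pose b := (2 ^ (L'.+1 ^ k))%:R * (C'%:R * M / lam ^+ r).
have b0 : 0 <= b by rewrite !mulr_ge0 // invr_ge0 ltW.
(* If one of the two points leaves [S - z], closedness of [S] yields a polynomial of degree [N] that
   cuts [W] properly. The components of the section then fall under the induction hypothesis. *)
have cut z : ~ (S (w + z) /\ S (w' + z)) ->
    rprob R sY (W `&` [set y | S (y + z)]) <= b.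
  move=> nS; have [w0 Ww0 Sw0] : exists2 w0, W w0 & ~ S (w0 + z).
    by have [?|?] := pselect (S (w + z)); [exists w' => // ?; exact: nS|exists w].
  have [g pg [gS gw0]] : exists2 g, polyfun N g &
      (forall x, S x -> g x = 0) /\ g (w0 + z) <> 0.
    apply: contrapT => ng; apply: Sw0; apply: clS => g pg gS.
    by apply: contrapT => gw0; apply: ng; exists g.
  have pgz := polyfun_shift z pg.
  have gW : ~ (forall x, W x -> g (x + z) = 0) by move=> /(_ _ Ww0).
  have dU := dim_le_cut irrW pgz gW dW (leqnn _) (leqnn _).
  have [Ws [sWs WsP cov]] := irred_decomposition L' (W `&` [set y | S (y + z)]).
  apply: le_trans (_ : (size Ws)%:R * (C'%:R * M / lam ^+ r) <= _).
    apply: rprob_bigcup cov => W' /WsP[W'U irrW' _].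
    apply: (H sY sZ S) => //.
    - by rewrite lam0.
    - by move=> _; exact: stay.
    - by move=> y /W'U[/hW].
    - apply: dim_le_sub dU => y /W'U[Wy Sy]; split=> //; exact: gS.
  by rewrite ler_wpM2r ?ler_nat // !mulr_ge0 // invr_ge0 ltW.
(* Count pairs [(y, z)] with [y] in [W] and [y + z] in [S] in both orders; shifts keeping both [w]
   and [w'] contribute the first term, all others at most [b]. *)
have main : lam * rprob R sY W <= lam / 2 * rprob R sY W + b.
  apply: (@le_trans _ _ (rexp sY (fun y => rexp sZ (fun z =>
      ind R W y * ind R [set z | S (y + z)] z)))).
    rewrite /rprob -rexpZ; apply: ler_rexp => y; rewrite rexpZ.
    have [Wy|nW] := pselect (W y); last by rewrite (indF nW) mulr0 mul0r.
    by rewrite (indT Wy) mulr1 mul1r; exact: hW.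
  rewrite rexp_swap; apply: (@le_trans _ _ (rexp sZ (fun z =>
      rprob R sY W * ind R [set z | S (w + z) /\ S (w' + z)] z + b))).
    apply: ler_rexp => z; rewrite (rprobI_ind sY W [set y | S (y + z)]).
    have [Sz|nSz] := pselect (S (w + z) /\ S (w' + z)).
      by rewrite indT // mulr1 ler_wpDr // le_rprob // => y [].
    by rewrite indF // mulr0 add0r; exact: cut.
  rewrite rexpD rexp_cst rexpZ lerD2r mulrC ler_wpM2r ?rprob_ge0 //.
  exact: stay.
have bE : b * 2 / lam <= (2 * (2 ^ (L'.+1 ^ k) * C')).+1%:R * M / lam ^+ r.+1.
  rewrite -[X in X%:R * M]addn1 natrD natrM natrM mulrDl mulrDl mul1r.
  have -> : 2 * ((2 ^ (L'.+1 ^ k))%:R * C'%:R) * M / lam ^+ r.+1 = b * 2 / lam.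
    by rewrite /b exprS; field; rewrite !gt_eqF.
  by rewrite ler_wpDr // mulr_ge0 // invr_ge0 ltW.
by apply: le_trans bE; rewrite ler_pdivlMr //; lra.
Qed.

(** If a shift of [F] by [v] still vanishes on [W] without [v] being a period, the nonzero
    difference also vanishes on [W] and has smaller differencing order; iterate. *)
Lemma minimal_vanishing k d (W : set 'rV[R]_k) F :
  polyfun d F -> (exists x, F x <> 0) -> (forall x, W x -> F x = 0) ->
  exists f, [/\ polyfun d f, exists x, f x <> 0, forall x, W x -> f x = 0 &
    forall v, (forall x, W x -> f (x + v) = 0) -> forall x, f (x + v) = f x].
Proof.
move=> pF; have [n nF] := polyfun_diff_vanish pF.
elim: n F nF pF => [F F0 _ [x /(_ (F0 x))]//|n IH F nF pF F0 FW].
have [H|] := pselect (forall v, (forall x, W x -> F (x + v) = 0) ->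
  forall x, F (x + v) = F x); first by exists F.
move=> /existsNP[v /not_implyP[Fv /existsNP[x Fx]]].
apply: (IH (fun x => F (x + v) - F x)).
- exact: nF.
- by apply: polyfunB => //; exact: polyfun_shift.
- by exists x => /eqP; rewrite subr_eq0 => /eqP.
- by move=> y Wy; rewrite Fv // FW // subrr.
Qed.

(** [A] eliminates a coordinate [j] with [v_j] nonzero by subtracting a multiple of [v]; [B]
    reinserts a zero there. *)
Lemma projection_along k (v : 'rV[R]_k.+1) : v != 0 ->
  exists (A : 'M[R]_(k.+1, k)) (B : 'M[R]_(k, k.+1)),
    B *m A = 1%:M /\ forall x, exists t, x *m A *m B = x + t *: v.
Proof.
move=> /rV0Pn[j vj].
pose A : 'M[R]_(k.+1, k) := \matrix_(i, l)
  ((i == lift j l)%:R - (i == j)%:R * (v ord0 j)^-1 * v ord0 (lift j l)).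
pose B : 'M[R]_(k, k.+1) := \matrix_(l, i) (i == lift j l)%:R.
have AE x l : (x *m A) ord0 l =
    x ord0 (lift j l) - x ord0 j * (v ord0 j)^-1 * v ord0 (lift j l).
  rewrite mxE (bigD1 j) //= (bigD1 (lift j l)) 1?eq_sym ?neq_lift //= big1 ?addr0.
    rewrite !mxE !eqxx (negPf (neq_lift j l)) eq_sym (negPf (neq_lift j l)).
    by rewrite !mul1r !mul0r subr0 sub0r mulr1 mulrN addrC mulrA.
  by move=> i /andP[ij il]; rewrite !mxE (negPf ij) (negPf il) !mul0r subr0 mulr0.
have BE (y : 'rV[R]_k) l : (y *m B) ord0 (lift j l) = y ord0 l.
  rewrite mxE (bigD1 l) //= big1 ?addr0 ?mxE ?eqxx ?mulr1 //.
  by move=> i il; rewrite mxE (inj_eq lift_inj) eq_sym (negPf il) mulr0.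
have BjE (y : 'rV[R]_k) : (y *m B) ord0 j = 0.
  by rewrite mxE big1 // => i _; rewrite mxE (negPf (neq_lift j i)) mulr0.
exists A, B; split.
  apply/row_matrixP => i; rewrite !rowE mulmx1 mulmxA; apply/rowP => l.
  by rewrite AE BE BjE !mul0r subr0.
move=> x; exists (- (x ord0 j * (v ord0 j)^-1)); apply/rowP => i; rewrite [in RHS]mxE.
rewrite [X in _ + X]mxE mulNr.
have [l ->|->] := unliftP j i; first by rewrite BE AE.
by rewrite BjE -mulrA mulVf // mulr1 subrr.
Qed.

Lemma spread_mulmx k l m (A : 'M[R]_(k, l)) (B : 'M[R]_(l, k)) (s : seq 'rV[R]_k) :
  B *m A = 1%:M -> spread m s -> spread m [seq x *m A | x <- s].
Proof.
move=> BA [Bs [r [sB spB E]]].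
exists [seq [seq x *m A | x <- b] | b <- Bs], [seq x *m A | x <- r].
split; first by rewrite size_map.
  move=> _ /mapP[b bB ->].
  have E1 : [seq x *m A | x <- b] = map (linfun (mulmxr A)) b.
    by apply: eq_map => x; rewrite lfunE.
  rewrite E1 -limg_span spB //.
  apply/vspaceP => y; rewrite [RHS]memvf; apply/memv_imgP; exists (y *m B).
    exact: memvf.
  by rewrite lfunE /= -mulmxA BA mulmx1.
by rewrite -map_flatten -map_cat perm_map.
Qed.

Lemma rprob_mulmx k l (A : 'M[R]_(k, l)) (s : seq 'rV[R]_k) (S : set 'rV[R]_l) :
  rprob R [seq x *m A | x <- s] S = rprob R s [set x | S (x *m A)].
Proof. exact: (rexp_map (mulmxr A)). Qed.

(** If the Hilbert function of [T] is too small, the functions of [k] coordinates that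
    interpolate the grid [{0..N}^k] become dependent on [T]. *)
Lemma grid_relation l k N (A : 'M[R]_(l, k)) (T : set 'rV[R]_l) :
  ~ hilbert_ge T (k * N) (N.+1 ^ k) ->
  exists g : 'rV[R]_k -> R,
    [/\ polyfun (k * N) g, exists y, g y <> 0 & forall x, T x -> g (x *m A) = 0].
Proof.
move=> nT.
(* [lift (al i) b] runs through the values in [{0..N}] other than [al i], so [p al] vanishes at
   every grid point except [al]. *)
pose p (al : {ffun 'I_k -> 'I_N.+1}) (y : 'rV[R]_k) :=
  \prod_(i < k) \prod_(b < N) (y ord0 i - (lift (al i) b)%:R).
have pp al : polyfun (k * N) (p al).
  rewrite -[X in (X * _)%N]card_ord -[X in (_ * X)%N]card_ord !cardT !enumT /=.
  apply: polyfun_prod => i; rewrite -[X in polyfun X _]muln1; apply: polyfun_prod => b.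
  by apply: polyfunB; [exact: polyfun_coord|exact: polyfun_cst'].
have : ~ indep_on T (fun al x => p al (x *m A)).
  move=> ind; apply: nT; exists {ffun 'I_k -> 'I_N.+1}, (fun al x => p al (x *m A)).
  split=> //; first by rewrite card_ffun !card_ord.
  move=> al; apply: (polyfun_eq (F := fun x => p al (x *m A + 0))).
    by move=> x; rewrite addr0.
  exact: polyfun_affine.
move=> /existsNP[c /not_implyP[cT /existsNP[al cal]]].
exists (fun y => \sum_al c al * p al y); split=> //.
  by apply: polyfun_sum => be; exact: polyfunZ.
exists (\row_i (al i)%:R) => /eqP; rewrite (bigD1 al) //= big1 ?addr0.
  rewrite mulf_eq0 => /orP[/eqP//|]; apply/negP/prodf_neq0 => i _.
  apply/prodf_neq0 => b _; rewrite mxE subr_eq0 eqr_nat.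
  exact: neq_lift.
move=> be /eqP beal; have [i bei] : exists i, be i <> al i.
  by apply/existsNP => H; apply: beal; apply/ffunP.
have [b E|/esym//] := unliftP (be i) (al i).
by rewrite /p (bigD1 i) //= (bigD1 b) //= mxE E subrr !mul0r mulr0.
Qed.

Lemma spread_halves k m (s : seq 'rV[R]_k) : spread m s ->
  exists sY sZ, [/\ perm_eq s (sY ++ sZ), spread m./2 sY & spread m./2 sZ].
Proof.
move=> [B [r [sB spB E]]].
have mB : (m./2 <= size B)%N by rewrite sB; lia.
exists (flatten (take m./2 B)), (flatten (drop m./2 B) ++ r); split.
- by rewrite catA -flatten_cat cat_take_drop.
- exists (take m./2 B), [::]; split; first by rewrite size_takel.
    by move=> b /mem_take; exact: spB.
  by rewrite cats0.
- exists (take m./2 (drop m./2 B)), (flatten (drop m./2 (drop m./2 B)) ++ r); split.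
  + by rewrite size_takel // size_drop sB; lia.
  + by move=> b /mem_take/mem_drop; exact: spB.
  + by rewrite catA -flatten_cat cat_take_drop.
Qed.

End Hypersurface.

(** * Induction on the ambient dimension *)

Section HypersurfaceBound.
Variable R : realType.

Definition hypersurface_bound (k d C : nat) : Prop :=
  forall (F : 'rV[R]_k -> R) m (s : seq 'rV[R]_k),
    polyfun d F -> (exists x, F x <> 0) -> (0 < m)%N -> spread m s ->
    rprob R s [set x | F x = 0] <= C%:R * rsqrt R m.

Lemma dim_le_hypersurface k d (F : 'rV[R]_k.+1 -> R) L :
  polyfun d F -> (exists x, F x <> 0) ->
  dim_le [set x | F x = 0] k (d.+1 ^ k.+1) L.
Proof.
move=> pF [x Fx]; rewrite -[X in dim_le _ _ X]mul1n -[X in dim_le X]setTI.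
apply: (dim_le_cut (N := L * d.+1) (@irred_uptoT R k.+1 _) pF _
  (@dim_leT R k.+1 (L * d.+1)) (leqnn _) (leqnn _)).
by move=> /(_ x I).
Qed.

(** A period makes [f] invariant along the whole line of [v], so it factors through the projection
    along [v]. *)
Lemma hypersurface_bound_periodic k d C (f : 'rV[R]_k.+1 -> R) v m
    (s : seq 'rV[R]_k.+1) :
  hypersurface_bound k d C -> polyfun d f -> (exists x, f x <> 0) -> v != 0 ->
  (forall x, f (x + v) = f x) -> (0 < m)%N -> spread m s ->
  rprob R s [set x | f x = 0] <= C%:R * rsqrt R m.
Proof.
move=> bnd pf [x0 fx0] v0 per m0 sp.
have [A [B [BA AB]]] := projection_along v0.
have fE x : f (x *m A *m B + 0) = f x.
  by have [t ->] := AB x; rewrite addr0 (polyfun_periodic pf per).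
have := bnd _ m _ (polyfun_affine B 0 pf) _ m0 (spread_mulmx BA sp).
rewrite rprob_mulmx => H; apply: le_trans (H _).
  by apply: le_rprob => x fx; rewrite /= fE.
by exists (x0 *m A); rewrite fE.
Qed.

(** For a non-period [v], the set where [S] meets its translate by [- v] has codimension
    two, so it projects into a hypersurface of [R^k]. *)
Lemma translate_meet_bound k d e N D C (f : 'rV[R]_k.+1 -> R) (S : set 'rV[R]_k.+1)
    m (s : seq 'rV[R]_k.+1) w v :
  (0 < k)%N -> (e * d.+1 ^ k * k ^ k.-1 <= D)%N -> (k * D * d.+1 <= N)%N ->
  hypersurface_bound k (k * D) C ->
  polyfun d f -> (forall x, S x -> f x = 0) ->
  ~ (forall x, S x -> f (x + v) = 0) ->
  irred_upto N S -> dim_le S k e N -> (0 < m)%N -> spread m s ->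
  rprob R s [set z | S (w + z) /\ S (w + v + z)] <= C%:R * rsqrt R m.
Proof.
case: k f S s w v => // k f S s w v _ eD DN bnd pf fS fv irrS dS m0 sp.
have dT := dim_le_cut irrS (polyfun_shift v pf) fv dS DN DN.
set T := _ `&` _ in dT.
(* The size of [D] bounds the Hilbert function by [D * D.+1 ^ k], just short of the number of grid
   points. *)
have nT : ~ hilbert_ge T (k.+1 * D) (D.+1 ^ k.+1).
  move=> /(dT _ _ (leqnn _)); apply/negP; rewrite -ltnNge.
  apply: (@leq_ltn_trans (e * d.+1 ^ k.+1 * (k.+1 * D.+1) ^ k)).
    rewrite leq_mul2l; apply/orP; right.
    by case: (k) => // k'; rewrite leq_exp2r //; nia.
  by rewrite expnMn mulnA [(D.+1 ^ k.+1)%N]expnS ltn_pmul2r ?expn_gt0.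
have v0 : (delta_mx ord0 ord0 : 'rV[R]_k.+2) != 0.
  by apply/eqP => /matrixP/(_ ord0 ord0)/eqP; rewrite !mxE !eqxx oner_eq0.
have [A [B [BA _]]] := projection_along v0.
have [g [pg [y gy] gT]] := grid_relation A nT.
have := bnd _ m _ (polyfun_shift (w *m A) pg) _ m0 (spread_mulmx BA sp).
rewrite rprob_mulmx => H; apply: le_trans (H _).
  apply: le_rprob => z [Sz Svz] /=; rewrite -mulmxDl addrC; apply: gT.
  by split=> //=; rewrite addrAC; exact: fS.
by exists (y - w *m A); rewrite subrK.
Qed.

Lemma spread_rsqrt_half m : (1 < m)%N -> rsqrt R m./2 <= 2 * rsqrt R m.
Proof. by move=> m1; apply: (@rsqrt_le R _ _ 2); lia. Qed.

(** The induction on [k] is uniform in the degree, because meeting a translate raises the degree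
    from [d] to [k * D]. *)
Lemma hypersurface_bound_exists k d : exists C, hypersurface_bound k d C.
Proof.
elim: k d => [|k IH] d.
  exists 0%N => F m s pF [x Fx] m0 sp; rewrite mul0r.
  apply: rexp_bound => y; rewrite indF //= => Fy; apply: Fx.
  by rewrite -Fy; congr F; apply/rowP; case.
have [Ca bndA] := IH d.
pose e := (d.+1 ^ k.+1)%N.
pose D := (e * d.+1 ^ k * k ^ k.-1)%N.
have [Cb bndB] := IH (k * D)%N.
(* The first summand is the degree needed for meeting translates; the second makes [F = 0] closed at
   degree [N]. *)
pose N := (k * D * d.+1 + d)%N.
have [C2 [L lvl]] := level_set_bound R k.+1 N k e.
pose C1 := (2 * (2 * Cb + 1 + 2 ^ (L.+1 ^ k.+1) * (C2 * 2 ^ k.+1)) + Ca + 1)%N.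
exists (2 ^ (N.+1 ^ k.+1) * C1)%N => F m s pF F0 m0 sp.
have clF : alg_closed N [set x | F x = 0].
  move=> x; apply; last by [].
  by apply: polyfun_le pF; rewrite leq_addl.
have [Ss [sSs SsP cov]] := irred_decomposition N [set x | F x = 0].
rewrite natrM -mulrA; apply: le_trans (_ : (size Ss)%:R * (C1%:R * rsqrt R m) <= _);
  last by rewrite ler_wpM2r ?mulr_ge0 ?rsqrt_ge0 // ler_nat.
apply: rprob_bigcup cov => S /SsP[SF irrS /(_ clF) clS].
have C1_le c : (c <= C1)%N -> c%:R * rsqrt R m <= C1%:R * rsqrt R m.
  by move=> cC; rewrite ler_wpM2r ?rsqrt_ge0 // ler_nat.
have [f [pf f0 fS fmin]] := minimal_vanishing pF F0 SF.
have [[v [v0 per]]|nper] :=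
    pselect (exists v, v != 0 /\ forall x, f (x + v) = f x).
  apply: (@le_trans _ _ (Ca%:R * rsqrt R m)); last by apply: C1_le; rewrite /C1; lia.
  apply: le_trans (hypersurface_bound_periodic bndA pf f0 v0 per m0 sp).
  exact: le_rprob.
have [m1|m1] := leqP m 1.
  have -> : m = 1%N by lia.
  rewrite /rsqrt sqrtr1 invr1 mulr1 (le_trans (rprob_le1 _ _ _)) // ler1n /C1.
  by lia.
pose n := m./2; have n0 : (0 < n)%N by rewrite /n; lia.
pose q := rsqrt R n; have q0 : 0 < q by exact: rsqrt_gt0.
have [sY [sZ [/perm_rexp E spY spZ]]] := spread_halves sp.
rewrite /rprob E -/(rprob R (sY ++ sZ) S) rprob_cat.
(* Large enough that [Cb * q], the bound for two translates at once, is at most [lam / 2]. *)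
pose lam : R := (2 * Cb + 1)%:R * q.
have lam0 : 0 < lam by rewrite mulr_gt0 // ltr0n addn1.
pose U := (2 * Cb + 1 + 2 ^ (L.+1 ^ k.+1) * (C2 * 2 ^ k.+1))%N.
suff : rexp sY (fun y => rprob R sZ [set z | S (y + z)]) <= U%:R * q.
  move=> /le_trans; apply; apply: (@le_trans _ _ ((2 * U)%:R * rsqrt R m)).
    rewrite mulnC natrM -mulrA ler_wpM2l //; exact: spread_rsqrt_half.
  by apply: C1_le; rewrite /C1 -/U; lia.
have lamU : lam <= U%:R * q by rewrite ler_wpM2r ?(ltW q0) // ler_nat /U leq_addr.
have [lam1|lam1] := leP lam 1; last first.
  apply: le_trans lamU; apply: le_trans (ltW lam1).
  by apply: rexp_bound => y; exact: rprob_le1.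
pose p y := rprob R sZ [set z | S (y + z)].
pose G := [set y | lam <= p y].
pose M := (2 * q) ^+ k.+1.
have hM y : rprob R sY [set y] <= M by exact: spread_point.
have stay : (0 < k)%N -> forall w w', w <> w' ->
    rprob R sZ [set z | S (w + z) /\ S (w' + z)] <= lam / 2.
  move=> k0 w w' ww'; apply: (@le_trans _ _ (Cb%:R * q)); last first.
    by rewrite /lam natrD natrM mulrDl mulrDl; lra.
  (* By the choice of [f], a shift that vanishes on [S] would come from a period, and there are no
     nonzero ones. *)
  have v0 : w' - w != 0 by rewrite subr_eq0; apply/eqP => /esym.
  have wE : w' = w + (w' - w) by rewrite addrC subrK.
  have nfv : ~ (forall x, S x -> f (x + (w' - w)) = 0).
    by move=> /fmin per; apply: nper; exists (w' - w).
  have dS : dim_le S k e N := dim_le_sub fS (dim_le_hypersurface (L := N) pf f0).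
  have := translate_meet_bound (D := D) w k0 (leqnn _) (leq_addr _ _) bndB
    pf fS nfv irrS dS n0 spZ.
  by rewrite -wE.
(* For fixed [z] the set lies in the translated hypersurface of [f], so its components have
   dimension at most [k], one less than the ambient space. *)
have cut z : rprob R sY (G `&` [set y | S (y + z)]) <=
    (2 ^ (L.+1 ^ k.+1))%:R * (C2%:R * M / lam ^+ k).
  have [Ws [sWs WsP covW]] := irred_decomposition L (G `&` [set y | S (y + z)]).
  apply: le_trans (_ : (size Ws)%:R * (C2%:R * M / lam ^+ k) <= _); last first.
    rewrite ler_wpM2r ?ler_nat // !mulr_ge0 ?invr_ge0 ?exprn_ge0 ?mulr_ge0 //; exact: ltW.
  apply: rprob_bigcup covW => W /WsP[WU irrW _].
  apply: (lvl sY sZ S) => //; first by rewrite lam0.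
    by move=> y /WU[].
  have := dim_le_hypersurface (L := L) (polyfun_shift z pf) _.
  move=> H; apply: dim_le_sub (H _); first by move=> y /WU[_]; exact: fS.
  by have [x fx] := f0; exists (x - z); rewrite subrK.
(* Points [y] outside [G] contribute at most [lam]; for those inside, the order of averaging is
   exchanged. *)
apply: (@le_trans _ _ (rexp sY (fun y => lam + rexp sZ (fun z =>
    ind R G y * ind R [set y | S (y + z)] y)))).
  apply: ler_rexp => y; rewrite rexpZ.
  have [Gy|/negP] := boolP (lam <= p y).
    by rewrite (indT (P := G)) // mul1r ler_wpDl // ltW.
  by move=> nG; rewrite (indF (P := G)) // mul0r addr0; move/negP: nG; rewrite -ltNge => /ltW.
rewrite rexpD rexp_cst rexp_swap.
apply: (@le_trans _ _ (lam + (2 ^ (L.+1 ^ k.+1))%:R * (C2%:R * M / lam ^+ k))).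
  rewrite lerD2l; apply: rexp_bound => z; rewrite rprobI_ind; exact: cut.
have qlam : q ^+ k <= lam ^+ k.
  by rewrite lerXn2r ?nnegrE ?(ltW q0) ?(ltW lam0) // ler_peMl ?(ltW q0) // ler1n addn1.
(* The [k.+1] factors [q] of the point bound against [k] factors [lam >= q] leave exactly one
   [q]. *)
have ML : M / lam ^+ k <= 2 ^+ k.+1 * q.
  rewrite ler_pdivrMr ?exprn_gt0 // /M exprMn [q ^+ k.+1]exprS -mulrA ler_wpM2l ?exprn_ge0 //.
  by rewrite ler_wpM2l ?(ltW q0).
rewrite /U natrD mulrDl -/lam lerD2l 2!natrM [(2 ^ k.+1)%:R]natrX -!mulrA.
by do 2 (rewrite ler_wpM2l //).
Qed.

End HypersurfaceBound.

(** * Semialgebraic sets and arbitrary nonzero vectors *)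

Section Semialgebraic.
Variable R : realType.

Lemma greedy_bases (V : vectType R) (M : nat) (s : seq V) :
  exists Bs rest, [/\ perm_eq s (flatten Bs ++ rest),
    (size (flatten Bs) <= \dim {:V} * size Bs)%N,
    forall b, b \in Bs -> <<b>>%VS = fullv &
    size Bs = M \/ (size Bs < M)%N /\ <<rest>>%VS <> fullv].
Proof.
elim: M => [|M [Bs [rest [sE sBs spB]]]].
  by exists [::], s; split=> //=; left.
case=> [sM|[sM nr]]; last first.
  by exists Bs, rest; split=> //; right; split=> //; exact: ltnW.
have [rf|nr] := pselect (<<rest>>%VS = fullv); last first.
  by exists Bs, rest; split=> //; right; split=> //; rewrite sM.
have [Y [Z [rYZ fY Yr]]] := free_sub_span rest.
exists (Y :: Bs), Z; split.
- apply: (perm_trans sE); rewrite /= -catA perm_sym perm_catCA perm_cat2l.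
  by rewrite perm_sym.
- rewrite /= size_cat mulnS leq_add //.
  by move: fY; rewrite /free Yr rf => /eqP ->.
- by move=> b; rewrite inE => /orP[/eqP->|/spB//]; rewrite Yr.
- by left; rewrite /= sM.
Qed.

Lemma subspace_param k (U : {vspace 'rV[R]_k}) :
  exists (B : 'M[R]_(\dim U, k)) (B' : 'M[R]_(k, \dim U)),
    B *m B' = 1%:M /\ forall x, x \in U -> exists y, x = y *m B.
Proof.
pose B : 'M[R]_(\dim U, k) := \matrix_(i, j) (vbasis U)`_i ord0 j.
have BE (y : 'rV_(\dim U)) : y *m B = \sum_i y ord0 i *: (vbasis U)`_i.
  apply/rowP => j; rewrite mxE summxE; apply: eq_bigr => i _.
  by rewrite !mxE.
have /row_freeP[B' BB'] : row_free B.
  apply: inj_row_free => y; rewrite BE => y0.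
  have /freeP fb := basis_free (vbasisP U).
  by apply/rowP => i; rewrite mxE; exact: (fb _ y0).
exists B, B'; split=> // x xU.
exists (\row_i coord (vbasis U) i x).
rewrite BE {1}(coord_vbasis xU); apply: eq_bigr => i _; by rewrite mxE.
Qed.

(** Extract disjoint bases greedily. If this stops early, at least half of the vectors lie in a
    proper subspace, and the induction on the dimension continues there; each descent loses a factor
    2. *)
Lemma spread_subspace k (s : seq 'rV[R]_k) :
  (forall a, a \in s -> a != 0) -> (0 < size s)%N ->
  exists (r m : nat) (B : 'M[R]_(r, k)) (B' : 'M[R]_(k, r)) s' t,
    [/\ (0 < r <= k)%N /\ (0 < m)%N, B *m B' = 1%:M,
        perm_eq s ([seq y *m B | y <- s'] ++ t), spread m s' &
        (size s <= 2 ^ k * k.+1 * m)%N].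
Proof.
elim/ltn_ind: k s => k IH s s0 sn.
have k0 : (0 < k)%N.
  rewrite lt0n; apply/eqP => k0; case: s sn s0 => // a s _ /(_ a (mem_head _ _)).
  by case/rV0Pn => i; have := ltn_ord i; rewrite [X in (_ < X)%N]k0.
pose M := (size s %/ (2 * k)).+1.
have [Bs [rest [sE sBs spB]]] := greedy_bases M s.
have dimk : \dim {: 'rV[R]_k} = k by rewrite dimvf /dim /= mul1n.
rewrite dimk in sBs; have n_lt := ltn_ceil (size s) (_ : 0 < 2 * k)%N.
have n_le := leq_trunc_div (size s) (2 * k).
have p1 n : (2 * n <= 2 ^ n * n.+1)%N.
  by case: n => // n; have := ltn_expl n (isT : 1 < 2)%N; rewrite expnS; nia.
case=> [sM|[sM nr]].
  exists k, M, 1%:M, 1%:M, s, [::]; split=> //.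
  - by rewrite k0 leqnn.
  - by rewrite mulmx1.
  - by rewrite cats0; under eq_map do rewrite mulmx1; rewrite map_id.
  - by exists Bs, rest.
  - have := p1 k; rewrite -/M in n_lt; have {}n_lt : (size s < M * (2 * k))%N by apply: n_lt; lia.
    move=> H; apply: (leq_trans (ltnW n_lt)); rewrite mulnC leq_mul2r.
    by rewrite H orbT.
have rk : (\dim <<rest>>%VS < \dim {: 'rV[R]_k})%N.
  rewrite ltn_neqAle dimvS ?subvf // andbT; apply/eqP => E; apply: nr.
  by apply/eqP; rewrite eqEdim subvf E leqnn.
rewrite dimk in rk.
(* Fewer than [M] bases of at most [k] vectors each use up no more than half of [s]. *)
have sr : (size s <= 2 * size rest)%N.
  have sE' := perm_size sE; rewrite size_cat in sE'.
  have : (k * size Bs <= k * (size s %/ (2 * k)))%N by rewrite leq_mul2l -ltnS sM orbT.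
  have : (2 * (k * (size s %/ (2 * k))) <= size s)%N by rewrite mulnA mulnC.
  have arith n f t a b : (n = f + t -> f <= a -> a <= b -> 2 * b <= n -> n <= 2 * t)%N.
    by lia.
  by move=> H1 H2; exact: arith sE' sBs H2 H1.
have [B [B' [BB' BU]]] := subspace_param <<rest>>%VS.
have [r' rE] : exists r', rest = [seq y *m B | y <- r'].
  have restU : {subset rest <= <<rest>>%VS} by move=> x; exact: memv_span.
  suff H l : {subset l <= <<rest>>%VS} -> exists l', l = [seq y *m B | y <- l'] by exact: H.
  elim: l => [|a l IHl] lU; first by exists [::].
  have [y ->] := BU _ (lU _ (mem_head _ _)).
  have [|l' ->] := IHl; first by move=> x xl; apply: lU; rewrite inE xl orbT.
  by exists (y :: l').
clear BU; move: (\dim <<rest>>%VS) B B' BB' rk r' rE => dr B B' BB' rk r' rE.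
have r'0 y : y \in r' -> y != 0.
  move=> yr'; have : y *m B != 0.
    by apply: s0; rewrite (perm_mem sE) mem_cat rE (map_f (fun y => y *m B) yr') orbT.
  by apply: contraNneq => ->; rewrite mul0mx.
have r'n : (0 < size r')%N by move: sr; rewrite rE size_map; lia.
have [q [m [C [C' [s' [t [[/andP[q0 qr] m0] CC' r'E sp sm]]]]]]] := IH _ rk r' r'0 r'n.
exists q, m, (C *m B), (B' *m C'), s', ([seq y *m B | y <- t] ++ flatten Bs); split=> //.
- by rewrite q0 m0 (leq_trans qr (ltnW rk)).
- by rewrite mulmxA -(mulmxA C) BB' mulmx1.
- apply: (perm_trans sE); rewrite perm_catC catA perm_cat2r rE.
  apply: (perm_trans (perm_map _ r'E)); rewrite map_cat perm_cat2r -map_comp.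
  by under eq_map do rewrite /= -mulmxA.
- apply: (leq_trans sr); rewrite rE size_map.
  have H : (2 * (2 ^ (dr) * (dr).+1) <= 2 ^ k * k.+1)%N.
    by rewrite mulnA -expnS leq_mul // ?leq_exp2l // ltnS ltnW.
  apply: (@leq_trans (2 * (2 ^ (dr) * (dr).+1 * m))).
    by rewrite leq_mul2l.
  by rewrite mulnA leq_mul2r H orbT.
Qed.

Lemma polyfun_peval k (p : mpoly.mpoly k R) : exists d, polyfun d (peval p).
Proof.
suff [d pd] : exists d, polyfun d (fun x : 'rV[R]_k =>
    \sum_(m <- mpoly.msupp p) mpoly.mcoeff m p * \prod_i x ord0 i ^+ mpoly.fun_of_multinom m i).
  by exists d; apply: polyfun_eq pd => x; rewrite /peval mpoly.mevalE.
elim: (mpoly.msupp p) => [|m r [d IH]].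
  by exists 0%N; apply: (polyfun_eq _ (polyfun_cst _ 0)) => x; rewrite big_nil.
have [e pe] : exists e, polyfun e (fun x : 'rV[R]_k => \prod_i x ord0 i ^+ mpoly.fun_of_multinom m i).
  elim: (index_enum _) => [|i t [e pe]].
    by exists 0%N; apply: (polyfun_eq _ (polyfun_cst _ 1)) => x; rewrite big_nil.
  have [f pf] : exists f, polyfun f (fun x : 'rV[R]_k => x ord0 i ^+ mpoly.fun_of_multinom m i).
    elim: (mpoly.fun_of_multinom m i) => [|n [f pf]].
      by exists 0%N; apply: (polyfun_eq _ (polyfun_cst _ 1)) => x; rewrite expr0.
    exists (1 + f)%N; apply: (polyfun_eq _ (polyfunM (polyfun_coord _ i) pf)) => x.
    by rewrite exprS.
  by exists (f + e)%N; apply: (polyfun_eq _ (polyfunM pf pe)) => x; rewrite big_cons.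
exists (maxn e d).
apply: (polyfun_eq _ (polyfunD (polyfun_le (leq_maxl e d) (polyfunZ (mpoly.mcoeff m p) pe))
  (polyfun_le (leq_maxr e d) IH))) => x.
by rewrite big_cons.
Qed.

(** * Local constancy of semialgebraic sets along lines *)

Lemma poly_sgr_near (q : {poly R}) : q.[0] != 0 ->
  exists2 eps, 0 < eps & forall t, `|t| < eps -> Num.sg q.[t] = Num.sg q.[0].
Proof.
move=> q0; have /cvgrPdist_lt/(_ `|q.[0]|) := @continuous_horner R q 0.
rewrite normr_gt0 => /(_ q0) /nbhs_ballP[eps eps0 H]; exists eps => // t te.
have := H t; rewrite /ball /= sub0r normrN => /(_ te).
have [qp|qn|qz] := ltrgt0P q.[0]; last by rewrite qz eqxx in q0.
  by move=> qt; rewrite !gtr0_sg //; move: qt; rewrite ltr_distlC; lra.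
by move=> qt; rewrite !ltr0_sg //; move: qt; rewrite ltr_distlC; lra.
Qed.

Definition line_constant k (S : set 'rV[R]_k) (F : 'rV[R]_k -> R) : Prop :=
  forall x v, F x <> 0 -> exists2 eps, 0 < eps &
    forall t, `|t| < eps -> (S (x + t *: v) <-> S x).

(** Off its zeros [G] keeps its sign on short segments. If [G] vanishes identically the condition is
    constant, and [F = 1] serves. *)
Lemma line_constant_polyfun k d (G : 'rV[R]_k -> R) (Q : R -> Prop) :
  (forall a b, Num.sg a = Num.sg b -> (Q a <-> Q b)) -> polyfun d G ->
  exists F, [/\ polyfun d F, exists x, F x <> 0 &
    line_constant [set x | Q (G x)] F].
Proof.
move=> Qsg pG; have [G0|/existsNP G0] := pselect (forall x, G x = 0).
  exists (fun=> 1); split; first exact: polyfun_cst'.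
    by exists 0; apply/eqP; exact: oner_neq0.
  by move=> x v _; exists 1 => // t _ /=; rewrite !G0.
exists G; split=> // x v /eqP Gx.
have [q qE] := polyfun_line x v pG.
have q0 : q.[0] = G x by rewrite qE scale0r addr0.
rewrite -q0 in Gx; have [eps eps0 H] := poly_sgr_near Gx.
by exists eps => // t /H; rewrite qE q0 => /Qsg.
Qed.

Lemma line_constant_combine k d1 d2 (F1 F2 : 'rV[R]_k -> R) (S1 S2 S : set 'rV[R]_k) :
  polyfun d1 F1 -> polyfun d2 F2 -> (exists x, F1 x <> 0) -> (exists x, F2 x <> 0) ->
  line_constant S1 F1 -> line_constant S2 F2 ->
  (forall x y, (S1 x <-> S1 y) -> (S2 x <-> S2 y) -> (S x <-> S y)) ->
  exists F, [/\ polyfun (d1 + d2) F, exists x, F x <> 0 & line_constant S F].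
Proof.
move=> p1 p2 [x1 n1] [x2 n2] l1 l2 HS.
exists (fun x => F1 x * F2 x); split; first exact: polyfunM.
  apply: contrapT => nx; have H x : F1 x * F2 x = 0.
    by apply: contrapT => ?; apply: nx; exists x.
  by have [/(_ x1)|/(_ x2)] := polyfun_domain p1 p2 H.
move=> x v F0.
have [|e1 e10 H1] := l1 x v; first by move=> z; apply: F0; rewrite z mul0r.
have [|e2 e20 H2] := l2 x v; first by move=> z; apply: F0; rewrite z mulr0.
exists (Num.min e1 e2); first by rewrite lt_min e10.
by move=> t; rewrite lt_min => /andP[/H1 ? /H2 ?]; exact: HS.
Qed.

(** The degree is fixed before the affine map [y *m B + z], which makes the final constant
    independent of the vectors. Boolean combinations multiply the polynomials. *)
Lemma semialgebraic_line_constant k (S : set 'rV[R]_k) : semialgebraic S ->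
  exists d, forall r (B : 'M[R]_(r, k)) z, exists F : 'rV[R]_r -> R,
    [/\ polyfun d F, exists x, F x <> 0 &
        line_constant [set y | S (y *m B + z)] F].
Proof.
elim=> {S} [p|p|A _ [d H]|A1 A2 _ [d1 H1] _ [d2 H2]|A1 A2 _ [d1 H1] _ [d2 H2]].
- have [d pd] := polyfun_peval p; exists d => r B z.
  apply: (line_constant_polyfun (Q := fun a => a = 0)) (polyfun_affine B z pd).
  move=> a b ab; split=> [a0|b0]; apply/eqP; rewrite -sgr_eq0.
    by rewrite -ab a0 sgr0.
  by rewrite ab b0 sgr0.
- have [d pd] := polyfun_peval p; exists d => r B z.
  apply: (line_constant_polyfun (Q := fun a => 0 < a)) (polyfun_affine B z pd).
  by move=> a b ab; rewrite -sgr_gt0 ab sgr_gt0.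
- exists d => r B z; have [F [pF F0 lF]] := H r B z; exists F; split=> // x v Fx.
  have [eps eps0 He] := lF x v Fx; exists eps => // t /He /= ?.
  by apply: not_iff_compat.
- exists (d1 + d2)%N => r B z; have [F1 [p1 n1 l1]] := H1 r B z.
  have [F2 [p2 n2 l2]] := H2 r B z.
  by apply: (line_constant_combine p1 p2 n1 n2 l1 l2) => x y /= ? ?; split=> -[]; tauto.
- exists (d1 + d2)%N => r B z; have [F1 [p1 n1 l1]] := H1 r B z.
  have [F2 [p2 n2 l2]] := H2 r B z.
  by apply: (line_constant_combine p1 p2 n1 n2 l1 l2) => x y /= ? ?; split=> -[]; tauto.
Qed.

(** At a point of the set with [F] nonzero, a short segment in a coordinate direction stays in the
    set; [B] is injective, so its image in [S] is nondegenerate. *)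
Lemma no_segment_vanish k r (S : set 'rV[R]_k) (B : 'M[R]_(r, k)) B' z F :
  ~ contains_line_segment S -> (0 < r)%N -> B *m B' = 1%:M ->
  line_constant [set y | S (y *m B + z)] F ->
  forall y, S (y *m B + z) -> F y = 0.
Proof.
move=> nS r0 BB' lF y Sy; apply: contrapT => Fy; apply: nS.
case: r r0 B B' BB' F lF y Sy Fy => // r _ B B' BB' F lF y Sy Fy.
pose v : 'rV[R]_r.+1 := delta_mx ord0 ord0.
have [eps eps0 He] := lF y v Fy.
exists (y *m B + z), ((y + (eps / 2) *: v) *m B + z); split.
  apply/eqP => /addIr /(congr1 (mulmx^~ B')); rewrite -!mulmxA BB' !mulmx1.
  move=> /rowP/(_ ord0); rewrite !mxE !eqxx mulr1 => /eqP.
  by rewrite addrC -subr_eq subrr eq_sym mulf_eq0 gt_eqF // invr_eq0 pnatr_eq0.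
move=> _ [t /andP[t0 t1] <-].
have /He[_ /(_ Sy) /=] : `|t * (eps / 2)| < eps.
  by rewrite ger0_norm; nra.
congr S; rewrite !mulmxDl -!scalemxAl; apply/rowP => j; rewrite !mxE; ring.
Qed.

Lemma rprob_semialgebraic k (S : set 'rV[R]_k) :
  semialgebraic S -> ~ contains_line_segment S ->
  exists C : nat, forall s : seq 'rV[R]_k,
    (forall a, a \in s -> a != 0) -> (0 < size s)%N ->
    rprob R s S <= C%:R * rsqrt R (size s).
Proof.
move=> /semialgebraic_line_constant[d Hd] nS.
have /choice[Cf Hf] r := hypersurface_bound_exists R r d.
(* The dimension [r] of the subspace depends on the vectors, so the constants of all [r <= k] are
   added. *)
pose C := (\sum_(r < k.+1) Cf r)%N; pose c := (2 ^ k * k.+1)%N.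
exists (C * c)%N => s s0 sn.
have [r [m [B [B' [s' [t [[/andP[r0 rk] m0] BB' /perm_rexp E sp sm]]]]]]] :=
  spread_subspace s0 sn.
rewrite /rprob E rexp_catC -/(rprob R _ S) rprob_cat.
apply: rexp_bound => z; rewrite rprob_mulmx.
have [F [pF F0 lF]] := Hd r B z.
apply: (@le_trans _ _ (rprob R s' [set x | F x = 0])).
  apply: le_rprob => y /=; rewrite addrC => Sy.
  exact: (no_segment_vanish nS r0 BB' lF Sy).
apply: (le_trans (Hf r F m s' pF F0 m0 sp)).
apply: (@le_trans _ _ (C%:R * rsqrt R m)).
  rewrite ler_wpM2r ?rsqrt_ge0 // ler_nat /C.
  by rewrite (bigD1 (Ordinal (rk : (r < k.+1)%N))) //= leq_addr.
(* [size s <= c * m] is weakened to [c ^ 2 * m], so that the factor is [c] and not its square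
   root. *)
rewrite natrM -mulrA ler_wpM2l //; apply: rsqrt_le => //.
apply: (leq_trans sm); rewrite leq_mul2r -/c; apply/orP; right.
by rewrite leq_pmulr // muln_gt0 expn_gt0.
Qed.

End Semialgebraic.

(** * From random variables to sign vectors *)

Section RandomSigns.
Variable R : realType.

(** Signs are assigned to all of [I], even outside [r]. Flipping the sign at [i] is an involution on
    sign vectors, and averaging over it gives the recursive step of [rexp]. *)
Lemma rexp_ffun (V : lmodType R) (I : finType) (r : seq I) (a : I -> V) (F : V -> R) :
  uniq r ->
  rexp [seq a i | i <- r] F =
  \sum_(sg : {ffun I -> bool})
     2^-1 ^+ #|I| * F (\sum_(i <- r) (-1) ^+ sg i *: a i).
Proof.
elim: r F => [|i r IH] F /=.
  move=> _; under eq_bigr do rewrite big_nil.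
  rewrite sumr_const card_ffun card_bool -[RHS]mulr_natl mulrA natrX -exprMn.
  by rewrite divff ?pnatr_eq0 // expr1n mul1r.
move=> /andP[ir ur]; rewrite !IH //.
pose flip (sg : {ffun I -> bool}) : {ffun I -> bool} :=
  [ffun j => if j == i then ~~ sg j else sg j].
have flipK : involutive flip.
  by move=> sg; apply/ffunP => j; rewrite !ffunE; case: eqP => // _; rewrite negbK.
pose H (sg : {ffun I -> bool}) := 2^-1 ^+ #|I| * F (\sum_(j <- i :: r) (-1) ^+ sg j *: a j) : R.
rewrite -[RHS]/(\sum_(sg : {ffun I -> bool}) H sg).
have -> : \sum_(sg : {ffun I -> bool}) H sg =
    (\sum_(sg : {ffun I -> bool}) (H sg + H (flip sg))) / 2.
  rewrite big_split /= [X in _ + X](_ : _ = \sum_(sg : {ffun I -> bool}) H sg).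
    by field.
  by rewrite [RHS](reindex_inj (inv_inj flipK)).
rewrite -big_split /=; congr (_ / _); apply: eq_bigr => sg _.
rewrite /H !big_cons -!mulrDr; congr (_ * _).
have -> : \sum_(j <- r) (-1) ^+ (flip sg) j *: a j = \sum_(j <- r) (-1) ^+ sg j *: a j.
  rewrite big_seq [RHS]big_seq; apply: eq_bigr => j jr; rewrite ffunE.
  by case: eqP => // ji; rewrite -ji jr in ir.
rewrite ffunE eqxx; case: (sg i); rewrite /= ?expr1 ?expr0 ?scale1r ?scaleN1r //.
exact: addrC.
Qed.

Section Events.
Variables (d : measure_display) (T : measurableType d) (P : probability T R).

Lemma le_measure_cover (I : finType) (Q : pred I) (A : I -> set T) (E : set T) :
  measurable E -> (forall i, measurable (A i)) ->
  (forall w, E w -> exists2 i, Q i & A i w) ->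
  (P E <= \sum_(i | Q i) P (A i))%E.
Proof.
move=> mE mA cov.
have mU (r : seq I) : measurable (\big[setU/set0]_(i <- r | Q i) A i).
  exact: bigsetU_measurable.
apply: (@le_trans _ _ (P (\big[setU/set0]_(i | Q i) A i))).
  apply: le_measure; rewrite ?inE // => w /cov[i Qi Aw].
  by rewrite -bigcup_seq_cond; exists i; rewrite /= ?mem_index_enum.
elim: (index_enum I) => [|i r IH]; first by rewrite !big_nil measure0.
rewrite !big_cons; case: (Q i) => //.
exact: (le_trans (measureU2 _ (mA i) (mU r)) (leeD2l _ IH)).
Qed.

Lemma measurable_polyfun k n (a : 'I_n -> 'rV[R]_k) (xi : 'I_n -> {RV P >-> R}) e
    (F : 'rV[R]_k -> R) :
  polyfun e F -> measurable_fun setT (fun w => F (\sum_(i < n) xi i w *: a i)).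
Proof.
elim=> {e F} [c|j|e F G _ mF _ mG|e f F G _ mF _ mG|//].
- exact: measurable_cst.
- have -> : (fun w => (\sum_(i < n) xi i w *: a i) ord0 j) =
      (fun w => \sum_(i < n) xi i w * a i ord0 j).
    by apply/funext => w; rewrite summxE; apply: eq_bigr => i _; rewrite mxE.
  apply: measurable_sum => i; apply: measurable_funM; last exact: measurable_cst.
  exact: measurable_funPT.
- exact: measurable_funD.
- exact: measurable_funM.
Qed.

Lemma measurable_semialgebraic k n (a : 'I_n -> 'rV[R]_k) (xi : 'I_n -> {RV P >-> R})
    (S : set 'rV[R]_k) :
  semialgebraic S -> measurable [set w : T | S (\sum_(i < n) xi i w *: a i)].
Proof.
elim=> {S} [p|p|A _ mA|A B _ mA _ mB|A B _ mA _ mB].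
- have [e /(measurable_polyfun a xi) mp] := polyfun_peval p.
  rewrite -[X in measurable X]setTI.
  by have := mp measurableT _ (measurable_set1 (0 : R)).
- have [e /(measurable_polyfun a xi) mp] := polyfun_peval p.
  have := mp measurableT _ (measurable_itv `]0 : R, +oo[).
  by rewrite setTI; congr measurable; apply/seteqP; split=> w /=; rewrite in_itv /= andbT.
- exact: measurableC.
- exact: measurableI.
- exact: measurableU.
Qed.

Lemma rademacher_null (X : {RV P >-> R}) : rademacher X ->
  P (~` (X @^-1` [set 1] `|` X @^-1` [set -1])) = 0%E.
Proof.
move=> [X1 XN1].
have m1 (c : R) : measurable (X @^-1` [set c]) by exact: measurable_funPTI.
rewrite probability_setC; last exact: measurableU.
have -> : P (X @^-1` [set 1] `|` X @^-1` [set -1]) =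
    (P (X @^-1` [set 1%R]) + P (X @^-1` [set (-1)%R]))%E.
  apply: measureU => //; apply/seteqP; split=> // w [/= -> /eqP].
  by rewrite -subr_eq0 opprK -(natrD _ 1 1) pnatr_eq0.
have -> : (P (X @^-1` [set 1%R]) + P (X @^-1` [set (-1)%R]) = 1%:E)%E.
  by rewrite X1 XN1 -EFinD; congr EFin; lra.
by rewrite subee.
Qed.

(** The event is covered by the sign patterns leading into [S], each of probability [2^-n] by
    independence, and by the null sets where some [xi i] is not a sign. *)
Lemma le_prob_rprob k n (a : 'I_n -> 'rV[R]_k) (xi : 'I_n -> {RV P >-> R})
    (S : set 'rV[R]_k) :
  semialgebraic S -> (forall i, rademacher (xi i)) -> mutually_independent xi ->
  (P [set w | S (\sum_(i < n) xi i w *: a i)%R] <=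
   (rprob R [seq a i | i <- enum 'I_n] S)%:E)%E.
Proof.
move=> sS rad ind.
pose val_of (sg : {ffun 'I_n -> bool}) := \sum_(i < n) (-1) ^+ sg i *: a i.
pose A (sg : {ffun 'I_n -> bool}) : set T :=
  \bigcap_(i in [set` [set: 'I_n]%SET]) (xi i @^-1` [set (-1) ^+ sg i]).
pose N (i : 'I_n) : set T := ~` (xi i @^-1` [set 1] `|` xi i @^-1` [set -1]).
pose B (s : {ffun 'I_n -> bool} + 'I_n) := match s with inl sg => A sg | inr i => N i end.
pose Q (s : {ffun 'I_n -> bool} + 'I_n) :=
  match s with inl sg => `[< S (val_of sg) >] | inr i => true end.
have m1 i (c : R) : measurable (xi i @^-1` [set c]) by exact: measurable_funPTI.
have PA sg : P (A sg) = (2^-1 ^+ n)%:E.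
  rewrite ind; last by move=> i _; exact: measurable_set1.
  rewrite (eq_bigr (fun=> (2^-1)%:E)).
    by rewrite prodEFin prodr_const cardsT card_ord.
  by move=> i _; have [X1 XN1] := rad i; case: (sg i); rewrite /= ?expr1 ?expr0.
have mA sg : measurable (A sg).
  by apply: fin_bigcap_measurable => // i _; exact: m1.
apply: (@le_trans _ _ (\sum_(s | Q s) P (B s))%E).
  apply: le_measure_cover; first exact: measurable_semialgebraic.
    by case=> [sg|i]; [exact: mA|apply: measurableC; exact: measurableU].
  move=> w Sw; have [[i Ni]|nN] := pselect (exists i, N i w); first by exists (inr i).
  pose sg := [ffun i : 'I_n => xi i w == -1].
  have sgE i : (-1) ^+ sg i = xi i w.
    rewrite ffunE; have : ~ N i w by move=> Ni; apply: nN; exists i.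
    move=> /contrapT[/= ->|/= ->]; last by rewrite eqxx.
    by rewrite -subr_eq0 opprK -(natrD _ 1 1) pnatr_eq0.
  exists (inl sg); last by move=> i _ /=.
  by apply/asboolP; rewrite /val_of; under eq_bigr do rewrite sgE.
rewrite big_sumType /= [X in (_ + X)%E]big1 ?adde0; last first.
  by move=> i _; exact: rademacher_null.
under eq_bigr do rewrite PA.
rewrite sumEFin lee_fin /rprob rexp_ffun ?enum_uniq // card_ord big_mkcond /=.
apply: ler_sum => sg _; rewrite big_enum /= -/(val_of sg).
by have [/asboolP Sv|nS] := boolP `[< S (val_of sg) >];
  [rewrite indT // mulr1|rewrite mulr_ge0 ?ind_ge0 // exprn_ge0].
Qed.

End Events.
End RandomSigns.

Theorem theorem1p8 (R : realType) (k : nat) (S : set 'rV[R]_k)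
    (hS : semialgebraic S) (hseg : ~ contains_line_segment S) :
  exists C : R,
    forall (n : nat) (a : 'I_n -> 'rV[R]_k)
      (d : measure_display) (T : measurableType d) (P : probability T R)
      (xi : 'I_n -> {RV P >-> R}),
      (0 < n)%N ->
      (forall i : 'I_n, a i != 0) ->
      (forall i : 'I_n, rademacher (xi i)) ->
      mutually_independent xi ->
      (P [set w : T | S (\sum_(i < n) xi i w *: a i)%R] <=
        (C * n%:R `^ (- 2^-1))%:E)%E.
Proof.
have [C HC] := rprob_semialgebraic hS hseg.
exists C%:R => n a d T P xi n0 a0 rad ind.
apply: (le_trans (le_prob_rprob a hS rad ind)); rewrite lee_fin.
have := HC [seq a i | i <- enum 'I_n]; rewrite size_map size_enum_ord => H.
rewrite powRN powR12_sqrt //; apply: H => // _ /mapP[i _ ->].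
exact: a0.
Qed.
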